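(* Suppose the standing assumptions (1)–(6) listed in the context hold and, additionally, that there exists $C\ge1$ (not depending on $g$) such that $\bar\pi_{g,0}=C\,\pi_{g,0}$ for all $1\le g\le G$. Then $$\lim_{m\to\infty}\mathrm{Pow}(\mathrm{ADDOW})\ \ge\ \limsup_{m\to\infty}\mathrm{Pow}(R)$$ for any $R\in\{\mathrm{BH},\mathrm{IHW}\}$.
   Context: Setting. Fix an integer $G\ge2$. For each $m$ one tests $m$ null hypotheses split into $G$ groups of sizes $m_1,\dots,m_G$ (nondecreasing integer sequences depending on $m$, $\sum_g m_g=m$). In group $g$, $H_{g,1},\dots,H_{g,m_g}\in\{0,1\}$ are fixed ($H_{g,i}=0$: the null is true), and the $p$-values $p_{g,1},\dots,p_{g,m_g}$ are $[0,1]$-valued random variables. Let $m_{g,1}=\sum_i H_{g,i}$, $m_{g,0}=m_g-m_{g,1}$, and $U(x)=\mathbf 1\{x>0\}\min(x,1)$. All limits are as $m\to\infty$. Standing assumptions: (1) if $H_{g,i}=0$, $p_{g,i}$ is uniform on $[0,1]$; (2) if $H_{g,i}=1$, $p_{g,i}$ has c.d.f. $F_g$ (not depending on $i$ or $m$), strictly concave on $[0,1]$, with $F_g(0)=0$; (3) there are $\pi_g>0$, $\pi_{g,0}>0$ with $m_g/m\to\pi_g$, $m_{g,0}/m_g\to\pi_{g,0}$, and $\pi_{g,1}=1-\pi_{g,0}>0$, for each $g$; (4) weak dependence: for each $g$ and $t\ge0$, in probability, $\frac1{m_{g,0}}\sum_{i}\mathbf 1\{p_{g,i}\le t,H_{g,i}=0\}\to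 U(t)$ and $\frac1{m_{g,1}}\sum_{i}\mathbf 1\{p_{g,i}\le t,H_{g,i}=1\}\to F_g(t)$ (no assumption on dependence across groups); (5) for each $g$ there is an estimator (random variable) $\hat\pi_{g,0}\in(0,1]$ with $\hat\pi_{g,0}\to\bar\pi_{g,0}$ in probability for some constant $\bar\pi_{g,0}\ge\pi_{g,0}$; (6) the target level satisfies $\alpha\in(\alpha^*,1)$, where $$\alpha^*=\inf_{w\in K^\infty}\frac1{\sum_g\pi_gw_g(\pi_{g,0}+\pi_{g,1}f_g(0^+))},\qquad K^\infty=\Big\{w\in\mathbb R_+^G:\sum_g\pi_g\bar\pi_{g,0}w_g\le1\Big\},$$ $f_g(0^+)=\lim_{x\to0^+}(F_g(x)-F_g(0))/x\in[0,\infty]$ (conventions $1/\infty=0$, $1/0=\infty$, $0\cdot\infty=0$). Procedures. For nondecreasing $h:[0,1]\to[0,1]$ with $h(0)=0$, $\mathcal I(h)=\sup\{u\in[0,1]:h(u)\ge u\}$. For a (possibly random) weight function $W:[0,1]\to\mathbb R_+^G$ (a vector $w$ is viewed as a constant function), $$\widehat G_W(u)=m^{-1}\sum_{g=1}^G\sum_{i=1}^{m_g}\mathbf 1\{p_{g,i}\le\alpha uW_g(u)\}.$$ If $\widehat G_W$ is nondecreasing, let $\hat u_W=\mathcal I(\widehat G_W)$ and $\mathrm{MWBH}(W)=\{(g,i):p_{g,i}\le\alpha\hat u_WW_g(\hat u_W)\}$ (set of rejected indices). Let $\widehat K=\{w\in\mathbb R_+^G:\sum_g\frac{m_g}m\hat\pi_{g,0}w_g\le1\}$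 and $\widehat K_{\mathrm{NE}}=\{w\in\mathbb R_+^G:\sum_g\frac{m_g}mw_g\le1\}$. Fix any random functions $\widehat W^*:[0,1]\to\widehat K$ and $\widehat W^*_{\mathrm{NE}}:[0,1]\to\widehat K_{\mathrm{NE}}$ with $\widehat G_{\widehat W^*}(u)=\max_{w\in\widehat K}\widehat G_w(u)$ and $\widehat G_{\widehat W^*_{\mathrm{NE}}}(u)=\max_{w\in\widehat K_{\mathrm{NE}}}\widehat G_w(u)$ for all $u\in[0,1]$ (these maxima exist and the resulting functions are nondecreasing; random functions are understood to be such that the quantities considered are measurable). Then - $\mathrm{ADDOW}=\mathrm{MWBH}(\widehat W^* )$; - $\mathrm{IHW}=\mathrm{MWBH}(\widehat W^*_{\mathrm{NE}})$; - $\mathrm{BH}=\mathrm{MWBH}((1,\dots,1))$ (constant weight vector). Criterion. For a procedure $R$ (random set of rejected indices) and $\mathcal H_1=\{(g,i):H_{g,i}=1\}$, $\mathrm{Pow}(R)=m^{-1}\mathbb E\big[|R\cap\mathcal H_1|\big]$. *)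

(* Defs.v *)
From HB Require Import structures.
From mathcomp Require Export all_boot all_order all_algebra.
From mathcomp Require Export all_classical all_reals all_analysis.

Set Implicit Arguments.
Unset Strict Implicit.
Unset Printing Implicit Defensive.

Export Order.TTheory GRing.Theory Num.Theory.
Export numFieldNormedType.Exports.

Local Open Scope classical_set_scope.
Local Open Scope ring_scope.

(* The m-th testing problem lives on its own probability space
   [(Omega m, P m)]; a single space common to all m is the constant family. *)
Definition cvg_in_prob (R : realType) (d : nat -> measure_display)
    (Omega : forall m, measurableType (d m)) (P : forall m, probability (Omega m) R)
    (X : forall m, Omega m -> R) (c : R) : Prop :=
  forall eps : R, 0 < eps ->
    P m [set w | eps < `|X m w - c|] @[m --> \oo] --> 0%E.

Definition strictly_concave_on01 (R : realType) (F : R -> R) : Prop :=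
  forall x y t : R, 0 <= x <= 1 -> 0 <= y <= 1 -> x != y -> 0 < t < 1 ->
    t * F x + (1 - t) * F y < F (t * x + (1 - t) * y).

Definition capped (R : realType) (x : R) : R := if 0 < x then Num.min x 1 else 0.

Definition num_alt (k : nat) (h : 'I_k -> bool) : nat := (\sum_(i < k) h i)%N.

Definition num_null (k : nat) (h : 'I_k -> bool) : nat := (k - num_alt h)%N.

Definition emp_null (R : realType) (k : nat) (h : 'I_k -> bool)
    (x : 'I_k -> R) (t : R) : R :=
  (num_null h)%:R^-1 * \sum_(i < k) ((x i <= t)%R && ~~ h i)%:R.

Definition emp_alt (R : realType) (k : nat) (h : 'I_k -> bool)
    (x : 'I_k -> R) (t : R) : R :=
  (num_alt h)%:R^-1 * \sum_(i < k) ((x i <= t)%R && h i)%:R.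

(* [f(0^+)], possibly [+oo]; for concave F the difference quotient is monotone
   and the limit exists in [\bar R]. *)
Definition slope0 (R : realType) (F : R -> R) : \bar R :=
  lim (((F x - F 0) / x)%:E @[x --> 0^'+]).

Definition weights (R : realType) (G : nat) (c : 'I_G -> R) : set ('I_G -> R) :=
  [set w | (forall g, 0 <= w g) /\ \sum_(g < G) c g * w g <= 1].

(* The library's extended-real operations implement the conventions
   [0^-1 = +oo], [+oo^-1 = 0] and [0 * +oo = 0]. *)
Definition alpha_star (R : realType) (G : nat) (pi pi0 pibar : 'I_G -> R)
    (F : 'I_G -> R -> R) : \bar R :=
  ereal_inf [set ((\sum_(g < G) (pi g * w g)%:E *
                     ((pi0 g)%:E + (1 - pi0 g)%:E * slope0 (F g)))^-1)%E
            | w in weights (fun g => pi g * pibar g)].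

(* Below, [m] is the total number of hypotheses, [n g] the size of group [g],
   [x g i] the realized p-values, and a weight function maps [u] to the vector
   [W u]; only its values at [u] in [0, 1] matter. *)

Definition Ghat (R : realType) (G m : nat) (n : 'I_G -> nat)
    (x : forall g, 'I_(n g) -> R) (alpha : R) (W : R -> 'I_G -> R) (u : R) : R :=
  m%:R^-1 * \sum_(g < G) \sum_(i < n g) (x g i <= alpha * u * W u g)%R%:R.

Definition crossing (R : realType) (h : R -> R) : R :=
  sup [set u | 0 <= u <= 1 /\ u <= h u].

Definition MWBH (R : realType) (G m : nat) (n : 'I_G -> nat)
    (x : forall g, 'I_(n g) -> R) (alpha : R) (W : R -> 'I_G -> R) :
    {set {g : 'I_G & 'I_(n g)}} :=
  let u := crossing (Ghat m x alpha W) in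
  [set r | x (tag r) (tagged r) <= alpha * u * W u (tag r)]%SET.

(* [W] takes values in [K] and attains [max_(w in K) Ghat_w(u)] at every [u]. *)
Definition optimal_weight (R : realType) (G m : nat) (n : 'I_G -> nat)
    (x : forall g, 'I_(n g) -> R) (alpha : R) (K : set ('I_G -> R))
    (W : R -> 'I_G -> R) : Prop :=
  forall u : R, 0 <= u <= 1 ->
    K (W u) /\
    forall w, K w -> Ghat m x alpha (fun=> w) u <= Ghat m x alpha W u.

Definition alternatives (G : nat) (n : 'I_G -> nat)
    (H : forall g, 'I_(n g) -> bool) : {set {g : 'I_G & 'I_(n g)}} :=
  [set r | H (tag r) (tagged r)]%SET.

Definition Pow (R : realType) (d : measure_display) (T : measurableType d)
    (P : probability T R) (G m : nat) (n : 'I_G -> nat)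
    (H : forall g, 'I_(n g) -> bool)
    (Rej : T -> {set {g : 'I_G & 'I_(n g)}}) : \bar R :=
  ((m%:R^-1)%:E * 'E_P[fun w => #|Rej w :&: alternatives H|%:R])%E.

(* What [Pow] needs for [#|Rej w :&: alternatives H|] to be a random variable;
   implied by measurability of [w |-> W w u g] for each [u] and [g]. *)
Definition measurable_rejection (d : measure_display) (T : measurableType d)
    (I : finType) (Rej : T -> {set I}) : Prop :=
  forall r : I, measurable [set w | r \in Rej w].

(* Main.v *)
(* Write thresholds as t_g = alpha u w_g and put nu_g = pi_g pi0_g,
   beta_g = pi_g (1 - pi0_g). In the limit a procedure at level u picks T in
   [0, 1]^G with C sum_g nu_g T_g <= alpha u and
   u <= sum_g nu_g T_g + sum_g beta_g F_g(T_g); let u* be the largest such level.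
   Because the budget is proportional to the null mass sum_g nu_g T_g, raising T
   until the budget is exhausted shows that no feasible T has power above
   u* - min(alpha u* / C, sum_g nu_g). ADDOW attains this value: its level tends
   to u*, and what it rejects is the total u* minus at most the largest null mass.
   BH and IHW have weights in {sum_g pi_g w_g <= 1}, which lies in the limiting
   budget set since pibar_g <= 1, so the same bound applies to them.
   Strict concavity of the F_g forces the level to converge to u*; uniqueness of
   the maximizing T is not needed. *)
Require Import Defs.
From mathcomp Require Import measurable_realfun ring lra.

Set Implicit Arguments.
Unset Strict Implicit.
Unset Printing Implicit Defensive.

Local Open Scope classical_set_scope.
Local Open Scope ring_scope.

(** * Concave distribution functions and the limit model *)

(** The last field is right-continuity at 0, in a form adapted to a monotone [F] vanishing there.
    With subadditivity it controls the increments of [F] uniformly. *)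
Record concave_cdf (R : realType) (F : R -> R) : Prop := ConcaveCdf {
  concave_cdf_strict : strictly_concave_on01 F;
  concave_cdf0 : F 0 = 0;
  concave_cdf_homo : {homo F : x y / x <= y};
  concave_cdf_le1 : forall x, F x <= 1;
  concave_cdf_right0 : forall e, 0 < e -> exists2 h, 0 < h <= 1 & F h < e }.

Section concave_cdf_theory.
Variables (R : realType) (F : R -> R).
Hypothesis hF : concave_cdf F.

Lemma concave_cdf_ge0 x : 0 <= x -> 0 <= F x.
Proof. by move=> x0; rewrite -(concave_cdf0 hF); exact: concave_cdf_homo. Qed.

Lemma concave_cdf_conc x y t : 0 <= x <= 1 -> 0 <= y <= 1 -> 0 <= t <= 1 ->
  t * F x + (1 - t) * F y <= F (t * x + (1 - t) * y).
Proof.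
move=> x01 y01 /andP[t0 t1].
have [->|xy] := eqVneq x y; first by rewrite -!mulrDl addrC subrK !mul1r.
move: t0; rewrite le_eqVlt => /predU1P[<-|t0]; first by rewrite !mul0r !add0r subr0 !mul1r.
move: t1; rewrite le_eqVlt => /predU1P[->|t1]; first by rewrite subrr !mul0r !addr0 !mul1r.
by apply/ltW/concave_cdf_strict => //; rewrite t0.
Qed.

Lemma concave_cdf_scale s t : 0 <= s <= 1 -> 0 <= t <= 1 -> s * F t <= F (s * t).
Proof.
move=> s01 t01; have := @concave_cdf_conc t 0 s t01 _ s01.
by rewrite (concave_cdf0 hF) !mulr0 !addr0; apply; rewrite lexx ler01.
Qed.

Lemma concave_cdf_scale_lt s t : 0 < s < 1 -> 0 < t <= 1 -> s * F t < F (s * t).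
Proof.
move=> s01 /andP[t0 t1]; have := @concave_cdf_strict _ _ hF t 0 s.
by rewrite (concave_cdf0 hF) !mulr0 !addr0; apply; rewrite ?lexx ?ler01 ?t1 ?ltW// gt_eqF.
Qed.

(** [x] and [h] are complementary fractions of [x + h], and [F] lies above its chord from the origin
    to [x + h]; the two chord bounds add up to the claim. *)
Lemma concave_cdf_subadd x h : 0 <= x -> 0 <= h -> x + h <= 1 ->
  F (x + h) <= F x + F h.
Proof.
move=> x0 h0 xh1; have [xh0|xh0] := leP (x + h) 0.
  have -> : x = 0 by lra.
  have -> : h = 0 by lra.
  by rewrite addr0 (concave_cdf0 hF) addr0.
have xhN0 : x + h != 0 by rewrite gt_eqF.
have F_ge y : 0 <= y <= x + h -> y / (x + h) * F (x + h) <= F y.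
  move=> /andP[y0 yxh]; have -> : F y = F (y / (x + h) * (x + h)) by rewrite divfK.
  apply: concave_cdf_scale; last by rewrite ltW.
  by rewrite divr_ge0 ?(ltW xh0)//= ler_pdivrMr// mul1r.
have -> : F (x + h) = x / (x + h) * F (x + h) + h / (x + h) * F (x + h).
  by rewrite -mulrDl -mulrDl divff// mul1r.
by apply: lerD; apply: F_ge; lra.
Qed.

(* Both [s * t] and [x] lie between [s * x] and [t]; the concavity inequalities
   at these two points, added with weights [1] and [s], give the claim. *)
Lemma concave_cdf_gap_homo s x t : 0 <= s <= 1 -> 0 <= x -> x <= t -> t <= 1 ->
  F (s * x) - s * F x <= F (s * t) - s * F t.
Proof.
move=> /andP[s0 s1] x0; rewrite le_eqVlt => /predU1P[->//|xt] t1.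
have sxx : s * x <= x by rewrite ler_piMl.
have sxst : s * x <= s * t by rewrite ler_wpM2l// ltW.
have stt : s * t <= t by rewrite ler_piMl// (le_trans x0) ?ltW.
have sx0 : 0 <= s * x by rewrite mulr_ge0.
have dN0 : t - s * x != 0 by rewrite gt_eqF// subr_gt0 (le_lt_trans sxx).
have d0 : 0 < t - s * x by lra.
pose w y := (y - s * x) / (t - s * x).
have Fw y : s * x <= y <= t -> w y * F t + (1 - w y) * F (s * x) <= F y.
  move=> /andP[xy yt]; have wE : w y * t + (1 - w y) * (s * x) = y.
    by rewrite /w; field.
  rewrite -[X in _ <= F X]wE.
  apply: concave_cdf_conc; first (apply/andP; split; lra).
    by apply/andP; split; lra.
  by rewrite divr_ge0/= ?ler_pdivrMr//; lra.
have w_eq : w (s * t) + s * w x = s by rewrite /w; field.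
have := Fw (s * t); rewrite sxst stt => /(_ isT) H1.
have := Fw x; rewrite sxx (ltW xt) => /(_ isT)/(ler_wpM2l s0) H2.
have : (w (s * t) + s * w x) * F t + (1 + s - (w (s * t) + s * w x)) * F (s * x)
    <= F (s * t) + s * F x.
  by apply: le_trans (lerD H1 H2); rewrite le_eqVlt; apply/orP; left; apply/eqP; ring.
by rewrite w_eq; lra.
Qed.

End concave_cdf_theory.

(** Seeding the minimum with 1 covers an empty index type and keeps the bound at most 1. *)
Lemma exists_lower_bound (R : realType) (I : finType) (a : I -> R) :
  (forall i, 0 < a i) -> exists2 b, 0 < b <= 1 & forall i, b <= a i.
Proof.
move=> a0; exists (\big[Num.min/1]_i a i); last by move=> i; exact: bigmin_le_cond.
by rewrite bigmin_le_id andbT; apply: lt_bigmin => //; exact: ltr01.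
Qed.

(** * The limiting optimization problem *)

Section limit_model.
Variables (R : realType) (G : nat) (nu beta : 'I_G -> R) (F : 'I_G -> R -> R).
Variables (C alpha : R).
Hypotheses (nu_gt0 : forall g, 0 < nu g) (beta_gt0 : forall g, 0 < beta g).
Hypothesis mass1 : \sum_g nu g + \sum_g beta g = 1.
Hypothesis hF : forall g, concave_cdf (F g).
Hypotheses (C_ge1 : 1 <= C) (alpha_gt0 : 0 < alpha).

Definition in_cube (T : 'I_G -> R) := forall g, 0 <= T g <= 1.
Definition null_mass (T : 'I_G -> R) := \sum_g nu g * T g.
Definition alt_mass (T : 'I_G -> R) := \sum_g beta g * F g (T g).
Definition mass T := null_mass T + alt_mass T.

Definition levels : set R := [set u | 0 <= u <= 1 /\
  exists T, [/\ in_cube T, C * null_mass T <= alpha * u & u <= mass T]].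

Definition ustar := sup levels.
(** The minimum is the null mass of a fully spent budget at level [ustar], capped by the total null
    mass, which is reached when every threshold equals 1. *)
Definition max_alt_mass := ustar - Num.min (alpha * ustar / C) (\sum_g nu g).

Let C_gt0 : 0 < C. Proof. exact: lt_le_trans C_ge1. Qed.

Lemma null_mass_ge0 T : in_cube T -> 0 <= null_mass T.
Proof.
move=> T01; apply: sumr_ge0 => g _; rewrite mulr_ge0 ?(ltW (nu_gt0 g))//.
by have /andP[] := T01 g.
Qed.

Lemma null_mass_le T : in_cube T -> null_mass T <= \sum_g nu g.
Proof.
move=> T01; apply: ler_sum => g _; rewrite ler_piMr ?(ltW (nu_gt0 g))//.
by have /andP[] := T01 g.
Qed.

Lemma alt_mass_ge0 T : in_cube T -> 0 <= alt_mass T.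
Proof.
move=> T01; apply: sumr_ge0 => g _; rewrite mulr_ge0 ?(ltW (beta_gt0 g))//.
by apply: concave_cdf_ge0 => //; have /andP[] := T01 g.
Qed.

Lemma mass_le1 T : in_cube T -> mass T <= 1.
Proof.
move=> T01; rewrite /mass -mass1 lerD ?null_mass_le//; apply: ler_sum => g _.
by rewrite ler_piMr ?(ltW (beta_gt0 g))// concave_cdf_le1.
Qed.

Lemma mass_ge0 T : in_cube T -> 0 <= mass T.
Proof. by move=> T01; rewrite addr_ge0 ?null_mass_ge0 ?alt_mass_ge0. Qed.

Lemma levels0 : levels 0.
Proof.
split; first by rewrite lexx ler01.
have T0 : in_cube (fun=> 0 : R) by move=> g; rewrite lexx ler01.
exists (fun=> 0); split; rewrite ?mass_ge0//.
by rewrite /null_mass big1 ?mulr0// => g _; rewrite mulr0.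
Qed.

Lemma has_sup_levels : has_sup levels.
Proof. by split; [exists 0; exact: levels0|exists 1 => u [/andP[]]]. Qed.

Lemma levels_le u : levels u -> u <= ustar.
Proof. by apply: ub_le_sup; case: has_sup_levels. Qed.

Lemma ustar_ge0 : 0 <= ustar.
Proof. exact/levels_le/levels0. Qed.

Lemma ustar_le1 : ustar <= 1.
Proof. by apply: ge_sup => [|u [/andP[]]//]; exists 0; exact: levels0. Qed.

(** If [mass T] exceeds [u], it is itself a level: [T] remains feasible there because the budget
    grows with the level. *)
Lemma mass_le_max u T : 0 <= u -> in_cube T -> C * null_mass T <= alpha * u ->
  mass T <= Num.max u ustar.
Proof.
move=> u0 T01 Tu; rewrite le_max; have [//|uT] := leP (mass T) u.
apply: levels_le; split; first by rewrite mass_ge0 ?mass_le1.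
exists T; split=> //; apply: (le_trans Tu); rewrite ler_wpM2l// ltW//.
Qed.

(* Moving [T] towards [1] until the budget is exhausted increases the
   alternative mass and makes the null mass equal to its largest possible
   value. *)
Lemma fill_up u T : in_cube T -> C * null_mass T <= alpha * u ->
  exists T', [/\ in_cube T', C * null_mass T' <= alpha * u,
    Num.min (alpha * u / C) (\sum_g nu g) <= null_mass T' &
    alt_mass T <= alt_mass T'].
Proof.
move=> T01 Tu; pose N := \sum_g nu g; pose fill l g := T g + l * (1 - T g).
have fill_cube l : 0 <= l <= 1 -> in_cube (fill l).
  move=> /andP[l0 l1] g; have /andP[t0 t1] := T01 g; rewrite /fill.
  have h0 : 0 <= l * (1 - T g) by rewrite mulr_ge0// subr_ge0.
  have h1 : l * (1 - T g) <= 1 - T g by rewrite ler_piMl// subr_ge0.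
  by apply/andP; split; lra.
have fill_null l : null_mass (fill l) = null_mass T + l * (N - null_mass T).
  rewrite /null_mass /N -sumrB mulr_sumr -big_split/=.
  by apply: eq_bigr => g _; rewrite /fill; ring.
have fill_alt l : 0 <= l <= 1 -> alt_mass T <= alt_mass (fill l).
  move=> /andP[l0 l1]; apply: ler_sum => g _; rewrite ler_pM2l//.
  apply: concave_cdf_homo => //; rewrite lerDl mulr_ge0// subr_ge0.
  by have /andP[] := T01 g.
have nullT : null_mass T <= alpha * u / C by rewrite ler_pdivlMr// mulrC.
(* If the budget covers the whole null mass, all thresholds can be set to 1. *)
have [NC|NC] := leP N (alpha * u / C).
  have l01 : 0 <= (1 : R) <= 1 by rewrite ler01 lexx.
  exists (fill 1); split; [exact: fill_cube| | |exact: fill_alt].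
    by rewrite fill_null mul1r addrC subrK mulrC -ler_pdivlMr.
  by rewrite fill_null mul1r addrC subrK.
have d0 : 0 < N - null_mass T by rewrite subr_gt0 (le_lt_trans nullT).
(* The null mass of [fill l] is affine in [l]; this [l] makes it equal to [alpha * u / C]. *)
pose l := (alpha * u / C - null_mass T) / (N - null_mass T).
have l01 : 0 <= l <= 1.
  rewrite ler_pdivrMr// mul1r lerD2r (ltW NC) andbT.
  by rewrite divr_ge0 ?(ltW d0)// subr_ge0.
have fillE : null_mass (fill l) = alpha * u / C.
  by rewrite fill_null /l divfK ?gt_eqF// addrC subrK.
exists (fill l); split; [exact: fill_cube| | |exact: fill_alt].
- by rewrite fillE mulrC divfK// gt_eqF.
- by rewrite fillE.
Qed.

(** After [fill_up] the null mass is at least the minimum taken at [u], hence at least the one at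
    [ustar], while the total mass is at most [u]. Their difference bounds the alternative mass; the
    term [u - ustar] leaves room for a random level slightly above [ustar]. *)
Lemma alt_mass_le u T : ustar <= u -> in_cube T -> C * null_mass T <= alpha * u ->
  alt_mass T <= max_alt_mass + (u - ustar).
Proof.
move=> leu T01 Tu; have [T' [T'01 T'u nullT' /le_trans]] := fill_up T01 Tu; apply.
have := mass_le_max (le_trans ustar_ge0 leu) T'01 T'u.
rewrite (max_idPl leu) /mass => massT'.
suff : Num.min (alpha * ustar / C) (\sum_g nu g) <=
       Num.min (alpha * u / C) (\sum_g nu g).
  by rewrite /max_alt_mass; lra.
apply: le_min2 => //; rewrite ler_pM2r ?invr_gt0// ler_pM2l//.
Qed.

Lemma max_alt_mass01 : 0 <= max_alt_mass <= 1.
Proof.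
have T0 : in_cube (fun=> 0 : R) by move=> g; rewrite lexx ler01.
apply/andP; split.
  have := @alt_mass_le ustar (fun=> 0) (lexx _) T0; rewrite subrr addr0.
  move=> H; apply: le_trans (alt_mass_ge0 T0) (H _).
  rewrite /null_mass big1 ?mulr0 => [|g _]; last by rewrite mulr0.
  by rewrite mulr_ge0 ?ustar_ge0// ltW.
rewrite (le_trans _ ustar_le1)// gerBl le_min sumr_ge0 => [|g _]; last exact: ltW.
by rewrite andbT divr_ge0 ?mulr_ge0 ?ustar_ge0// ltW.
Qed.

Lemma massE T : mass T = \sum_g (nu g * T g + beta g * F g (T g)).
Proof. by rewrite /mass -big_split. Qed.

(** Strict concavity made uniform in [T]. A mass of at least [k] forces some coordinate above a
    fixed [x]; by [concave_cdf_gap_homo] its gain is at least the positive gain at [x], and the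
    other coordinates gain a nonnegative amount. *)
Lemma mass_gap s k : 0 < s < 1 -> 0 < k -> exists2 gam, 0 < gam &
  forall T, in_cube T -> k <= mass T -> s * mass T + gam <= mass (fun g => s * T g).
Proof.
move=> s01 k0; have s01' : 0 <= s <= 1 by move/andP: s01 => [/ltW-> /ltW->].
(* If every coordinate were at most the [x] chosen below, all [T g] and [F g (T g)] would be at most
   [2 * e], so the mass would be at most [k / 2]. *)
pose e := k / 4.
have e0 : 0 < e by rewrite divr_gt0.
have [h h01 Fh] : exists2 h : 'I_G -> R, forall g, 0 < h g <= 1 & forall g, F g (h g) < e.
  have /choice[h hP] g : exists x, 0 < x <= 1 /\ F g x < e.
    by have [x] := concave_cdf_right0 (hF g) e0; exists x.
  by exists h => g; have [] := hP g.
have [b /andP[b0 b1] bh] := exists_lower_bound (fun g => proj1 (andP (h01 g))).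
pose x := Num.min b e.
have x0 : 0 < x by rewrite lt_min b0.
have x1 : x <= 1 by rewrite ge_min b1.
have Fx g : F g x < e.
  by apply: le_lt_trans (Fh g); apply: concave_cdf_homo => //; rewrite ge_min bh.
have gain_gt0 g : 0 < beta g * (F g (s * x) - s * F g x).
  by rewrite mulr_gt0// subr_gt0 concave_cdf_scale_lt// x0.
have [gam /andP[gam0 _] gamle] := exists_lower_bound gain_gt0.
exists gam => // T T01 kT.
have gain_ge0 g : s * (nu g * T g + beta g * F g (T g)) <=
    nu g * (s * T g) + beta g * F g (s * T g).
  rewrite mulrDr mulrCA lerD2l mulrCA ler_pM2l//.
  by apply: concave_cdf_scale.
have [g xT] : exists g, x < T g.
  apply: contrapT => /forallNP noT.
  suff : mass T < k by rewrite ltNge kT.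
  have : mass T <= \sum_(g < G) 2 * e * (nu g + beta g).
    rewrite massE; apply: ler_sum => g _.
    have /negP := noT g; rewrite -leNgt => Tx.
    have := concave_cdf_homo (hF g) Tx; have := Fx g.
    have := Tx; rewrite le_min => /andP[_ Te] Fxe FT.
    have HF : F g (T g) <= 2 * e by lra.
    have HT : T g <= 2 * e by lra.
    have := ler_wpM2l (ltW (nu_gt0 g)) HT; have := ler_wpM2l (ltW (beta_gt0 g)) HF.
    lra.
  move=> /le_lt_trans; apply; rewrite -mulr_sumr big_split/= mass1 mulr1 /e; lra.
rewrite !massE (bigD1 g)//= [leRHS](bigD1 g)//= mulrDr mulr_sumr.
suff : s * (nu g * T g + beta g * F g (T g)) + gam <=
    nu g * (s * T g) + beta g * F g (s * T g).
  by move=> Hg; rewrite addrAC lerD// ler_sum.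
have /andP[_ T1] := T01 g.
have := concave_cdf_gap_homo (hF g) s01' (ltW x0) (ltW xT) T1.
by move=> /(ler_wpM2l (ltW (beta_gt0 g))); have := gamle g; lra.
Qed.

Lemma null_massZ s T : null_mass (fun g => s * T g) = s * null_mass T.
Proof. by rewrite /null_mass mulr_sumr; apply: eq_bigr => g _; rewrite mulrCA. Qed.

Lemma in_cubeZ s T : 0 <= s <= 1 -> in_cube T -> in_cube (fun g => s * T g).
Proof.
move=> /andP[s0 s1] T01 g; have /andP[t0 t1] := T01 g.
by rewrite mulr_ge0//= mulr_ile1.
Qed.

(** Stability of [ustar] under small violations of both constraints. Shrinking [T] by [s] creates
    the gain of [mass_gap], which pays for the errors, so a level slightly above [s * u] is truly
    attained. Thus [s * u < ustar], which contradicts [ustar + e < u] by the choice of [s]. *)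
Lemma level_upper e : 0 < e -> exists2 del, 0 < del & forall u T, in_cube T ->
  C * null_mass T <= alpha * u + del -> u <= mass T + del -> u <= ustar + e.
Proof.
move=> e0; pose s := (1 + e)^-1.
have e1 : 0 < 1 + e by lra.
have s0 : 0 < s by rewrite invr_gt0.
have s1 : s < 1 by rewrite invf_lt1//; lra.
have [gam gam0 gamP] := @mass_gap s (e / 2) (introT andP (conj s0 s1)) (divr_gt0 e0 (ltr0Sn _ _)).
have a1 : 0 < 1 + alpha^-1 by rewrite addr_gt0 ?invr_gt0.
(* The first bound keeps [mass T] above [e / 2]; the second gives [del + del / alpha <= gam], so the
   gain covers the level error and the budget error. *)
exists (Num.min (e / 2) (gam / (1 + alpha^-1))).
  by rewrite lt_min !divr_gt0.
set del := Num.min _ _ => u T T01 Tu uT; rewrite leNgt; apply/negP => ltu.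
have del0 : 0 < del by rewrite lt_min !divr_gt0.
have dele : del <= e / 2 by rewrite ge_min lexx.
have delgam : del + del / alpha <= gam.
  rewrite -[X in X + _]mulr1 -mulrDr -ler_pdivlMr//.
  by rewrite ge_min lexx orbT.
have u0 := ustar_ge0; have u1 := ustar_le1.
have kT : e / 2 <= mass T by lra.
have := gamP T T01 kT; set T' := fun g => _ => gainT.
have T'01 : in_cube T' by apply: in_cubeZ => //; rewrite !ltW.
have sdel : s * del <= del by rewrite ler_piMl// ltW.
have da0 : 0 < del / alpha by rewrite divr_gt0.
have su0 : 0 <= s * u by rewrite mulr_ge0; lra.
(* Raising the level by [del / alpha] enlarges the budget by [del], which absorbs the budget
   error. *)
pose v := s * u + del / alpha.
have vT : v <= mass T'.
  by have := ler_wpM2l (ltW s0) uT; rewrite mulrDr /v; lra.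
have : v <= ustar.
  apply: levels_le; split.
    by rewrite (le_trans vT) ?mass_le1// andbT /v; lra.
  exists T'; split=> //; rewrite null_massZ mulrCA.
  apply: le_trans (ler_wpM2l (ltW s0) Tu) _.
  by rewrite mulrDr /v [leRHS]mulrDr mulrCA lerD2l mulrCA divff ?gt_eqF// mulr1.
apply/negP; rewrite -ltNge; apply: (@lt_trans _ _ (s * u)); last by rewrite /v; lra.
rewrite mulrC ltr_pdivlMr//; apply: le_lt_trans ltu.
by rewrite mulrDr mulr1 lerD2l ler_piMl// ltW.
Qed.

(** Both constraints must be strict to survive random perturbations. A feasible [T] at a level [u1]
    above [ustar - e] is shrunk by [(ustar - e) / u1]: it then fits the budget at [ustar - e], and
    by [mass_gap] its mass still exceeds [ustar - e]. *)
Lemma level_lower e : 0 < e -> e < ustar -> exists u T,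
  [/\ ustar - e <= u, 0 < u <= 1, in_cube T, C * null_mass T < alpha * u & u < mass T].
Proof.
move=> e0 eu; pose u0 := ustar - e.
have u00 : 0 < u0 by rewrite subr_gt0.
have [u1 [/andP[u10 u11] [T [T01 Tu1 u1T]]] u01] : exists2 u1, levels u1 & u0 < u1.
  by apply: sup_gt; [exists 0; exact: levels0|rewrite -[X in _ < X]/ustar gtrBl].
have u1gt0 : 0 < u1 by exact: lt_trans u01.
pose s := u0 / u1.
have s0 : 0 < s by rewrite divr_gt0.
have s1 : s < 1 by rewrite ltr_pdivrMr// mul1r.
have [gam gam0 gamP] := @mass_gap s u1 (introT andP (conj s0 s1)) u1gt0.
have := gamP T T01 u1T; set T' := fun g => _ => gainT.
have su1 : s * u1 = u0 by rewrite divfK// gt_eqF.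
have T'01 : in_cube T' by apply: in_cubeZ => //; rewrite !ltW.
have u0T' : u0 < mass T'.
  by apply: lt_le_trans gainT; rewrite -su1 ltr_pwDr// ler_wpM2l// ltW.
have T'1 := mass_le1 T'01.
(* The midpoint leaves slack on both sides: more budget than at [u0], and less than the available
   mass. *)
exists ((u0 + mass T') / 2), T'; split=> //.
- by rewrite -/u0; lra.
- by apply/andP; split; lra.
2: by lra.
apply: (@le_lt_trans _ _ (alpha * u0)); last by rewrite ltr_pM2l//; lra.
by rewrite null_massZ mulrCA -su1 [leRHS]mulrCA ler_wpM2l// ltW.
Qed.

End limit_model.

(** * Empirical distribution functions and rejection counts *)

Section crossing_theory.
Variables (R : realType) (h : R -> R).

Lemma crossing_le1 : 0 <= h 0 -> crossing h <= 1.
Proof.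
by move=> h0; apply: ge_sup => [|u [/andP[]]//]; exists 0; rewrite /= lexx ler01.
Qed.

Lemma le_crossing u : 0 <= u <= 1 -> u <= h u -> u <= crossing h.
Proof. by move=> u01 uh; apply: ub_le_sup => //; exists 1 => v [/andP[]]. Qed.

Lemma crossing_ge0 : 0 <= h 0 -> 0 <= crossing h.
Proof. by apply: le_crossing; rewrite lexx ler01. Qed.

(** Monotonicity replaces continuity: a point [v] of the set lying above [h (crossing h)] would
    satisfy [v <= h v <= h (crossing h)]. *)
Lemma crossing_attained : 0 <= h 0 ->
  {in `[0, 1] &, {homo h : u v / u <= v}} -> crossing h <= h (crossing h).
Proof.
move=> h0 h_homo; rewrite leNgt; apply/negP => hlt.
have [v [v01 vh] ltv] : exists2 v, 0 <= v <= 1 /\ v <= h v & h (crossing h) < v.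
  by apply: sup_gt => //; exists 0; rewrite /= lexx ler01.
have vc := le_crossing v01 vh; move: ltv; apply/negP; rewrite -leNgt.
apply: le_trans vh _; apply: h_homo => //; rewrite in_itv//=.
by rewrite crossing_ge0// crossing_le1.
Qed.

End crossing_theory.

Section empirical_cdf.
Variables (R : realType) (k : nat).
Implicit Types (h : 'I_k -> bool) (x : 'I_k -> R) (t : R).

Lemma num_alt_le h : (num_alt h <= k)%N.
Proof. by rewrite -[leqRHS]card_ord -sum1_card leq_sum// => i _; exact: leq_b1. Qed.

Lemma num_nullE h : num_null h = num_alt (fun i => ~~ h i).
Proof.
rewrite /num_null /num_alt; apply/eqP; rewrite -(eqn_add2r (\sum_(i < k) h i)).
rewrite (subnK (num_alt_le h)).
rewrite -big_split/= (eq_bigr (fun=> 1%N)) ?sum1_card ?card_ord// => i _.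
by case: (h i).
Qed.

(** Complementing the truth pattern transfers every fact about [emp_alt] to [emp_null]. *)
Lemma emp_nullE h x t : emp_null h x t = emp_alt (fun i => ~~ h i) x t.
Proof. by rewrite /emp_null num_nullE. Qed.

Lemma emp_count_le h x t : \sum_(i < k) ((x i <= t) && h i)%:R <= (num_alt h)%:R :> R.
Proof.
rewrite /num_alt natr_sum; apply: ler_sum => i _; rewrite ler_nat.
by case: (x i <= t).
Qed.

Lemma emp_alt_count h x t :
  (num_alt h)%:R * emp_alt h x t = \sum_(i < k) ((x i <= t) && h i)%:R.
Proof.
(* Without alternatives the inverse is 0 by convention, and the count on the right vanishes as
   well. *)
rewrite /emp_alt mulrA; have [h0|hN0] := eqVneq (num_alt h) 0%N; last first.
  by rewrite divff ?mul1r// pnatr_eq0.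
have := emp_count_le h x t; rewrite h0 !mul0r => le0.
by apply/esym/le_anti; rewrite le0 sumr_ge0.
Qed.

Lemma emp_alt_ge0 h x t : 0 <= emp_alt h x t.
Proof. by rewrite mulr_ge0 ?invr_ge0// sumr_ge0. Qed.

Lemma emp_alt_le1 h x t : emp_alt h x t <= 1.
Proof.
rewrite /emp_alt; have [->|hN0] := eqVneq (num_alt h) 0%N.
  by rewrite invr0 mul0r.
by rewrite mulrC ler_pdivrMr ?ltr0n ?lt0n// mul1r emp_count_le.
Qed.

Lemma emp_alt_homo h x : {homo emp_alt h x : s t / s <= t}.
Proof.
move=> s t st; rewrite ler_wpM2l ?invr_ge0//; apply: ler_sum => i _.
rewrite ler_nat; case: (boolP (x i <= s)) => [xs|]; last by [].
by rewrite (le_trans xs).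
Qed.

Lemma emp_alt_min1 h x t : (forall i, x i <= 1) ->
  emp_alt h x (Num.min t 1) = emp_alt h x t.
Proof.
move=> x1; rewrite /emp_alt; congr (_ * _); apply: eq_bigr => i _.
by rewrite le_min x1 andbT.
Qed.

End empirical_cdf.

(** * Rejection counts in terms of empirical distribution functions *)

Section rejections.
Variables (R : realType) (G m : nat) (n : 'I_G -> nat).
Variables (x : forall g, 'I_(n g) -> R) (H : forall g, 'I_(n g) -> bool) (alpha : R).
Implicit Type W : R -> 'I_G -> R.

Lemma GhatE W u : Ghat m x alpha W u =
  \sum_g (num_null (@H g))%:R / m%:R * emp_null (@H g) (@x g) (alpha * u * W u g) +
  \sum_g (num_alt (@H g))%:R / m%:R * emp_alt (@H g) (@x g) (alpha * u * W u g).
Proof.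
rewrite /Ghat mulr_sumr -big_split/=; apply: eq_bigr => g _.
set t := alpha * u * W u g.
rewrite ![_%:R / _ * _]mulrAC -mulrDl mulrC emp_nullE num_nullE !emp_alt_count.
congr (_ * _); rewrite -big_split/=; apply: eq_bigr => i _.
by rewrite -natrD; case: (_ <= _); case: (H i).
Qed.

Lemma rejected_alternativesE W (u := crossing (Ghat m x alpha W)) :
  #|MWBH m x alpha W :&: alternatives H|%:R / m%:R =
  \sum_g (num_alt (@H g))%:R / m%:R * emp_alt (@H g) (@x g) (alpha * u * W u g) :> R.
Proof.
rewrite -sum1_card natr_sum big_mkcond/= mulr_suml.
under [RHS]eq_bigr do rewrite mulrAC emp_alt_count mulr_suml.
rewrite (sig_big_dep xpredT (fun _ => xpredT)
  (fun g i => ((x i <= alpha * u * W u g) && H i)%:R / m%:R))/=.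
by apply: eq_bigr => r _; rewrite !inE; case: ifP.
Qed.

Lemma rejected_alternatives_le (Rej : {set {g : 'I_G & 'I_(n g)}}) :
  (\sum_(g < G) n g)%N = m -> #|Rej :&: alternatives H|%:R <= m%:R :> R.
Proof.
move=> nm; rewrite ler_nat (leq_trans (max_card _))// -nm card_tagged.
by rewrite sumnE big_map big_enum/= leq_sum// => g _; rewrite card_ord.
Qed.

Lemma Ghat_ge0 W u : 0 <= Ghat m x alpha W u.
Proof. by rewrite mulr_ge0 ?invr_ge0//; do 2 apply: sumr_ge0 => ? _. Qed.

Lemma Ghat_cst_homo w u v : 0 <= alpha -> (forall g, 0 <= w g) -> u <= v ->
  Ghat m x alpha (fun=> w) u <= Ghat m x alpha (fun=> w) v.
Proof.
move=> a0 w0 uv; rewrite ler_wpM2l ?invr_ge0//.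
do 2 apply: ler_sum => ? _; rewrite ler_nat.
case: (boolP (_ <= alpha * u * _)) => [xu|]; last by [].
by rewrite (le_trans xu)// ler_wpM2r// ler_wpM2l.
Qed.

(** The optimal weight at [u], held constant, stays admissible at [v]; its count does not drop from
    [u] to [v], and the optimum at [v] dominates it. *)
Lemma Ghat_optimal_homo c W : 0 <= alpha -> optimal_weight m x alpha (weights c) W ->
  {in `[0, 1] &, {homo Ghat m x alpha W : u v / u <= v}}.
Proof.
move=> a0 Wopt u v; rewrite !in_itv/= => u01 v01 uv.
have [[Wu0 Wu1] _] := Wopt u u01; have [_ Wv] := Wopt v v01.
apply: le_trans (Wv (W u) _); last by split.
exact: (Ghat_cst_homo a0 Wu0 uv).
Qed.

End rejections.

(** * Events of probability tending to one *)

Section expectation_bounds.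
Variables (d : measure_display) (T : measurableType d) (R : realType).
Variable P : probability T R.
Implicit Types (X Y : T -> R) (B : set T).

(* Integrals of nonnegative functions are suprema over simple functions, so
   no measurability is needed here. *)
Lemma ge0_le_expectation X Y : (forall w, 0 <= X w) -> (forall w, X w <= Y w) ->
  ('E_P[X] <= 'E_P[Y])%E.
Proof.
move=> X0 XY; have Y0 w : 0 <= Y w by apply: le_trans (XY w).
rewrite unlock !ge0_integralTE; [|by move=> w; rewrite lee_fin..].
by apply: le_ereal_sup => _ [h hX <-]; exists h => // w; rewrite (le_trans (hX w))// lee_fin.
Qed.

(** [B] is the bad event: [X] is dominated by [k * (c + \1_B)], whose integral is explicit. *)
Lemma expectation_le_off X B k c : measurable B -> 0 <= k -> 0 <= c ->
  (forall w, 0 <= X w <= k) -> (forall w, ~ B w -> X w <= k * c) ->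
  ('E_P[X] <= k%:E * (c%:E + P B))%E.
Proof.
move=> mB k0 c0 Xk Xc.
pose Y w : R := k * (c + \1_B w).
apply: (@le_trans _ _ ('E_P[Y])%E).
  apply: ge0_le_expectation => w; rewrite /Y; first by have /andP[] := Xk w.
  have /andP[_ Xkw] := Xk w; have [Bw|nBw] := pselect (B w).
    rewrite indicE mem_set// (le_trans Xkw)// ler_peMr// lerDr//.
  by rewrite indicE memNset// addr0 Xc.
rewrite unlock /Y; under eq_integral do rewrite EFinM EFinD.
rewrite ge0_integralZl_EFin//; last first.
- apply: emeasurable_funD; first exact: measurable_cst.
  by apply/measurable_EFinP.
- by move=> w _; rewrite -EFinD lee_fin addr_ge0.
rewrite ge0_integralD//; last first.
- by apply/measurable_EFinP.
rewrite integral_indic// setIT (integral_cst _ measurableT c%:E).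
by rewrite [X in (_ * (_ * X + _) <= _)%E]probability_setT mule1.
Qed.

Lemma expectation_ge_off X B k c : measurable B -> 0 <= k -> 0 <= c ->
  (forall w, 0 <= X w) -> (forall w, ~ B w -> k * c <= X w) ->
  (k%:E * (c%:E * (1 - P B)) <= 'E_P[X])%E.
Proof.
move=> mB k0 c0 X0 Xc.
pose Y w : R := k * c * \1_(~` B) w.
apply: (@le_trans _ _ ('E_P[Y])%E); last first.
  apply: ge0_le_expectation => w; rewrite /Y; first by rewrite !mulr_ge0.
  have [Bw|nBw] := pselect (B w); last by rewrite indicE mem_set// mulr1 Xc.
  by rewrite indicE memNset ?mulr0//; apply.
rewrite unlock /Y; under eq_integral do rewrite EFinM.
have mBC : measurable (~` B) by exact: measurableC.
rewrite ge0_integralZl_EFin//; last 2 first.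
- by apply/measurable_EFinP.
- exact: mulr_ge0.
by rewrite integral_indic// setIT [X in (_ <= _ * X)%E]probability_setC// EFinM muleA.
Qed.

End expectation_bounds.

Section high_probability.
Variables (R : realType) (d : nat -> measure_display).
Variables (Omega : forall m, measurableType (d m)) (P : forall m, probability (Omega m) R).

(* [E m] has inner probability tending to [1]; the events met below need not
   be measurable. *)
Definition whp (E : forall m, set (Omega m)) : Prop :=
  exists B : forall m, set (Omega m),
    [/\ forall m, measurable (B m), forall m w, ~ B m w -> E m w &
        P m (B m) @[m --> \oo] --> 0%E].

Lemma whp_sub E E' : whp E -> (forall m, E m `<=` E' m) -> whp E'.
Proof. by move=> [B [mB BE PB]] EE'; exists B; split=> // m w /BE/EE'. Qed.

Lemma whpI E E' : whp E -> whp E' -> whp (fun m => E m `&` E' m).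
Proof.
move=> [B [mB BE PB]] [B' [mB' BE' PB']]; exists (fun m => B m `|` B' m); split.
- by move=> m; exact: measurableU.
- by move=> m w /not_orP[/BE ? /BE' ?].
apply: (@squeeze_cvge _ _ _ _ (cst 0%E) _ (fun m => P m (B m) + P m (B' m))%E).
- by apply: nearW => m; rewrite measure_ge0 measureU2.
- exact: cvg_cst.
- by rewrite -[X in _ --> X]adde0; exact: cvgeD.
Qed.

Lemma whp_near E : (\forall m \near \oo, forall w, E m w) -> whp E.
Proof.
(* The bad event is empty or everything, hence measurable whatever [E m] is. *)
move=> nE; exists (fun m => if `[< forall w, E m w >] then set0 else setT).
split.
- by move=> m; case: ifP.
- by move=> m w; case: asboolP => [|_ /(_ I)//].
apply: cvg_near_cst; near=> m; rewrite ifT ?measure0//.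
by apply/asboolP; near: m.
Unshelve. all: by end_near. Qed.

(** Extracts a sample point, so that a pointwise bound on estimators passes to their limit in
    probability. If every [E m] were empty, all bad events would have probability 1. *)
Lemma whp_nonempty E : whp E -> exists m (w : Omega m), E m w.
Proof.
move=> [B [mB BE PB]]; apply: contrapT => noE.
have BT m : B m = setT.
  rewrite -subTset => w _; apply: contrapT => /BE Ew.
  by apply: noE; exists m, w.
have /cvg_lim : P m (B m) @[m --> \oo] --> 1%E.
  by apply: cvg_near_cst; apply: nearW => m; rewrite BT probability_setT.
rewrite (cvg_lim _ PB)// => /(_ (@ereal_hausdorff R))/eqP.
by rewrite eq_sym onee_eq0.
Qed.

Lemma whp_forall (I : finType) (E : I -> forall m, set (Omega m)) :
  (forall i, whp (E i)) -> whp (fun m => [set w | forall i, E i m w]).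
Proof.
move=> hE.
have hs (s : seq I) : whp (fun m => [set w | forall i, i \in s -> E i m w]).
  elim: s => [|i s IHs]; first by apply: whp_near; exact: nearW.
  apply: whp_sub (whpI (hE i) IHs) _ => m w [Ei Es] j.
  by rewrite inE => /predU1P[->//|/Es].
by apply: whp_sub (hs (enum I)) _ => m w Ew i; apply: Ew; rewrite mem_enum.
Qed.

Lemma cvg_in_prob_whp (X : forall m, Omega m -> R) c e :
  (forall m, measurable_fun [set: Omega m] (X m)) -> cvg_in_prob P X c -> 0 < e ->
  whp (fun m => [set w | `|X m w - c| <= e]).
Proof.
move=> mX Xc e0; exists (fun m => [set w | e < `|X m w - c|]); split.
- move=> m; rewrite -[X in measurable X]setTI.
  have mXc : measurable_fun setT (fun w => `|X m w - c|).
    by apply: measurableT_comp => //; exact: measurable_funB.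
  have := mXc measurableT `]e, +oo[%classic (measurable_itv _).
  congr (measurable _); apply/seteqP; split=> w /=.
  by rewrite in_itv/= andbT. by rewrite in_itv/= andbT.
- by move=> m w /negP; rewrite -leNgt.
- exact: Xc.
Qed.

(* The grid argument of the Glivenko-Cantelli theorem; subadditivity of [phi]
   and its smallness near [0] provide a uniform modulus of continuity. *)
Lemma whp_uniform_ub (X : forall m, Omega m -> R -> R) (phi : R -> R) del :
  (forall m w, {homo X m w : s t / s <= t}) ->
  (forall m t, measurable_fun [set: Omega m] (X m ^~ t)) ->
  (forall t, 0 <= t <= 1 -> cvg_in_prob P (fun m w => X m w t) (phi t)) ->
  {homo phi : s t / s <= t} ->
  (forall s t, 0 <= s -> 0 <= t -> s + t <= 1 -> phi (s + t) <= phi s + phi t) ->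
  (forall e, 0 < e -> exists2 h, 0 < h <= 1 & phi h < e) ->
  0 < del ->
  whp (fun m => [set w | forall t, 0 <= t <= 1 -> X m w t <= phi t + del]).
Proof.
move=> X_homo mX Xphi phi_homo phi_sub phi0 del0.
have del2 : 0 < del / 2 by rewrite divr_gt0.
have [h /andP[h0 h1] phih] := phi0 _ del2.
(* [N] steps of length [h] cover the unit interval; grid points past 1 are capped at 1. *)
pose N := (Num.trunc h^-1).+1.
pose s (j : 'I_N.+1) := Num.min (j%:R * h) 1.
have s01 j : 0 <= s j <= 1 by rewrite /s le_min ler01 ge_min lexx orbT !andbT mulr_ge0// ltW.
have gridP j : whp (fun m => [set w | `|X m w (s j) - phi (s j)| <= del / 2]).
  by apply: cvg_in_prob_whp => //; exact: Xphi.
apply: whp_sub (whp_forall gridP) _ => m w Ew t /andP[t0 t1].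
have th0 : 0 <= t / h by rewrite divr_ge0// ltW.
have /andP[lo hi] := trunc_itv th0.
have jN : ((Num.trunc (t / h)).+1 < N.+1)%N.
  rewrite ltnS /N ltnS; apply: le_truncn.
  by rewrite ler_pdivrMr// mulVf ?gt_eqF.
(* The grid point just to the right of [t], within distance [h]: monotonicity of [X] moves [t]
   there, and subadditivity of [phi] brings it back at cost [phi h < del / 2]. *)
pose j := Ordinal jN.
have jh : t <= j%:R * h by rewrite -ler_pdivrMr//= ltW.
have jh' : j%:R * h <= t + h.
  by rewrite /= -natr1 mulrDl mul1r lerD2r -ler_pdivlMr.
have ts : t <= s j by rewrite le_min jh.
have sth : s j - t <= h by rewrite lerBlDl ge_min jh'.
have /andP[sj0 sj1] := s01 j.
apply: le_trans (X_homo m w _ _ ts) _.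
have := Ew j; rewrite /= ler_distl => /andP[_ Xs].
have : phi (t + (s j - t)) <= phi t + phi (s j - t).
  by apply: phi_sub => //; [rewrite subr_ge0|rewrite addrC subrK].
rewrite addrC subrK; have := phi_homo _ _ sth; lra.
Qed.

(** * From high-probability bounds to expectations *)

Section expectation_limits.
Variables (X : forall m, Omega m -> R) (l : R).
Arguments X : clear implicits.
Hypothesis X01 : forall m w, 0 <= X m w <= m%:R.
Arguments X01 : clear implicits.
Hypothesis l01 : 0 <= l <= 1.

Lemma near_expectation_le :
  (forall e, 0 < e -> whp (fun m => [set w | X m w <= m%:R * (l + e)])) ->
  forall e, 0 < e -> \forall m \near \oo, ((m%:R^-1)%:E * 'E_(P m)[X m] <= (l + e)%:E)%E.
Proof.
move=> Xl e e0; have e2 : 0 < e / 2 by rewrite divr_gt0.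
have [B [mB BX PB]] := Xl _ e2; have /andP[l0 _] := l01.
have nPB : \forall m \near \oo, (P m (B m) < (e / 2)%:E)%E.
  by apply: (PB [set x | (x < (e / 2)%:E)%E]); apply: open_ereal_lt'; rewrite lte_fin.
near=> m.
have m0 : (0 < m%:R :> R) by rewrite ltr0n; near: m; exact: nbhs_infty_gt.
have PBe : (P m (B m) <= (e / 2)%:E)%E.
  by apply: ltW; near: m; exact: nPB.
have le0 : 0 <= l + e / 2 by rewrite addr_ge0 // ltW.
have := expectation_le_off (P m) (mB m) (ltW m0) le0 (X01 m) (@BX m).
rewrite lee_pdivrMl//; move=> /le_trans; apply.
rewrite lee_pmul2l//; apply: (@le_trans _ _ ((l + e / 2)%:E + (e / 2)%:E)%E).
  by rewrite leeD2l.
by rewrite -EFinD lee_fin -addrA -splitr.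
Unshelve. all: by end_near. Qed.

Lemma near_expectation_ge :
  (forall e, 0 < e -> whp (fun m => [set w | m%:R * (l - e) <= X m w])) ->
  forall e, 0 < e -> \forall m \near \oo, ((l - e)%:E <= (m%:R^-1)%:E * 'E_(P m)[X m])%E.
Proof.
move=> Xl e e0; have e2 : 0 < e / 2 by rewrite divr_gt0.
have [B [mB BX PB]] := Xl _ e2; have /andP[l0 l1] := l01.
have nPB : \forall m \near \oo, (P m (B m) < (e / 2)%:E)%E.
  by apply: (PB [set x | (x < (e / 2)%:E)%E]); apply: open_ereal_lt'; rewrite lte_fin.
have X0 m w : 0 <= X m w by have /andP[] := X01 m w.
near=> m.
have m0 : (0 < m%:R :> R) by rewrite ltr0n; near: m; exact: nbhs_infty_gt.
have PBe : (P m (B m) <= (e / 2)%:E)%E.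
  by apply: ltW; near: m; exact: nPB.
rewrite lee_pdivlMl//.
(* Truncation at 0 gives the nonnegative constant that [expectation_ge_off] asks for, and [c <= 1]
   bounds the loss [c * P(B)] by [e / 2]. *)
pose c := Num.max 0 (l - e / 2).
have c0 : 0 <= c by rewrite le_max lexx.
have BXc (w : Omega m) : ~ B m w -> m%:R * c <= X m w.
  by move=> /BX /= Xw; rewrite /c; case: (leP 0) => // _; rewrite mulr0 X0.
apply: le_trans (expectation_ge_off (P m) (mB m) (ltW m0) c0 (X0 m) BXc).
rewrite lee_pmul2l//.
have Pfin : (P m (B m)) \is a fin_num by exact: fin_num_measure.
rewrite -(fineK Pfin) -EFinB -EFinM lee_fin; move: PBe; rewrite -(fineK Pfin) lee_fin.
have : 0 <= fine (P m (B m)) by exact: fine_ge0.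
set q := fine _ => q0 qe.
have c1 : c <= 1 by rewrite ge_max ler01/=; lra.
have cl : l - e / 2 <= c by rewrite le_max lexx orbT.
have : c * q <= q by rewrite ler_piMl.
rewrite /=; lra.
Unshelve. all: by end_near. Qed.

End expectation_limits.

End high_probability.

Lemma limn_esup_le_near (R : realType) (u : nat -> \bar R) (l : R) :
  (forall e, 0 < e -> \forall m \near \oo, (u m <= (l + e)%:E)%E) ->
  (limn_esup u <= l%:E)%E.
Proof.
move=> ul; apply/lee_addgt0Pr => e e0.
apply: (@le_trans _ _ (ereal_sup (u @` [set m | (u m <= (l + e)%:E)%E]))).
  by apply: ereal_inf_lbound; exists [set m | (u m <= (l + e)%:E)%E] => //; exact: ul.
by apply: ge_ereal_sup => _ [m um <-].
Qed.

Lemma cvge_near_bounds (R : realType) (u : nat -> \bar R) (l : R) :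
  (forall e, 0 < e -> \forall m \near \oo, (u m <= (l + e)%:E)%E) ->
  (forall e, 0 < e -> \forall m \near \oo, ((l - e)%:E <= u m)%E) ->
  u m @[m --> \oo] --> l%:E.
Proof.
move=> ule uge; apply/fine_cvgP; split.
  near=> m; rewrite fin_numE; apply/andP; split.
    by rewrite gt_eqF// (lt_le_trans (ltNyr (l - 1)))//; near: m; exact: uge.
  by rewrite lt_eqF// (le_lt_trans _ (ltry (l + 1)))//; near: m; exact: ule.
apply/cvgrPdist_le => e e0; near=> m.
have um_le : (u m <= (l + e)%:E)%E by near: m; exact: ule.
have um_ge : ((l - e)%:E <= u m)%E by near: m; exact: uge.
move: um_le um_ge => /=; case: (u m) => [r| |]//=.
by rewrite !lee_fin distrC ler_distl => -> ->.
Unshelve. all: by end_near. Qed.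

(** * Asymptotics of weighted procedures *)

Lemma measurable_emp_alt (R : realType) (d : measure_display) (T : measurableType d)
    (k : nat) (h : 'I_k -> bool) (p : 'I_k -> T -> R) (t : R) :
  (forall i, measurable_fun [set: T] (p i)) ->
  measurable_fun [set: T] (fun w => emp_alt h (fun i => p i w) t).
Proof.
move=> mp; apply: measurable_funM; first exact: measurable_cst.
apply: measurable_sum => i.
case: (h i); last by under eq_fun do rewrite andbF; exact: measurable_cst.
under eq_fun do rewrite andbT.
have mle : measurable_fun setT (fun w => p i w <= t).
  by apply: measurable_fun_ler => //; exact: measurable_cst.
rewrite (_ : (fun w => _) = (fun w => if p i w <= t then 1 else 0)).
  by apply: measurable_fun_ifT => //; exact: measurable_cst.
by apply/funext => w; case: ifP.
Qed.

Section weighted_sums.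
Variables (R : realType) (G : nat) (nu a e phi : 'I_G -> R) (del : R).
Hypothesis nu01 : forall g, 0 <= nu g <= 1.
Hypothesis e01 : forall g, 0 <= e g <= 1.
Hypothesis a_nu : forall g, `|a g - nu g| <= del.
Hypothesis del_ge0 : 0 <= del.

(** In each group the coefficient error and the factor error cost at most [del] each, because the
    cofactors [e g] and [nu g] lie in the unit interval. *)
Lemma weighted_sum_le : (forall g, e g <= phi g + del) ->
  \sum_g a g * e g <= \sum_g nu g * phi g + 2 * del * G%:R.
Proof.
move=> e_phi; have -> : 2 * del * G%:R = \sum_(g < G) 2 * del.
  by rewrite sumr_const card_ord mulr_natr.
rewrite -big_split/=; apply: ler_sum => g _.
have /andP[nu0 nu1] := nu01 g; have /andP[e0 e1] := e01 g.
have := a_nu g; rewrite ler_norml lerBlDr => /andP[_ /(ler_wpM2r e0)].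
have := ler_wpM2l nu0 (e_phi g); rewrite mulrDr mulrDl.
have : nu g * del <= del by rewrite ler_piMl.
have : del * e g <= del by rewrite ler_piMr.
lra.
Qed.

Lemma weighted_sum_ge : (forall g, phi g - del <= e g) ->
  \sum_g nu g * phi g - 2 * del * G%:R <= \sum_g a g * e g.
Proof.
move=> e_phi; have -> : 2 * del * G%:R = \sum_(g < G) 2 * del.
  by rewrite sumr_const card_ord mulr_natr.
rewrite -sumrB; apply: ler_sum => g _.
have /andP[nu0 nu1] := nu01 g; have /andP[e0 e1] := e01 g.
have := a_nu g; rewrite ler_norml lerBrDr addrC => /andP[/(ler_wpM2r e0) + _].
have := ler_wpM2l nu0 (e_phi g); rewrite mulrBr mulrBl.
have : nu g * del <= del by rewrite ler_piMl.
have : del * e g <= del by rewrite ler_piMr.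
lra.
Qed.

End weighted_sums.

Section asymptotics.
Variables (R : realType) (G : nat).
Variables (d : nat -> measure_display) (Omega : forall m, measurableType (d m)).
Variables (P : forall m, probability (Omega m) R).
Variables (n : nat -> 'I_G -> nat) (H : forall m (g : 'I_G), 'I_(n m g) -> bool).
Variable p : forall m (g : 'I_G), 'I_(n m g) -> {RV (P m) >-> R}.
Variables (nu beta : 'I_G -> R) (F : 'I_G -> R -> R) (C alpha : R).
Hypothesis n_sum : forall m, (\sum_(g < G) n m g)%N = m.
Hypothesis p_le1 : forall m g (i : 'I_(n m g)) w, p i w <= 1.
Hypotheses (nu_gt0 : forall g, 0 < nu g) (beta_gt0 : forall g, 0 < beta g).
Hypothesis mass1 : \sum_g nu g + \sum_g beta g = 1.
Hypothesis hF : forall g, concave_cdf (F g).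
Hypotheses (C_ge1 : 1 <= C) (alpha_gt0 : 0 < alpha).
Hypothesis cvg_nu : forall g,
  ((num_null (@H m g))%:R / m%:R : R) @[m --> \oo] --> nu g.
Hypothesis cvg_beta : forall g,
  ((num_alt (@H m g))%:R / m%:R : R) @[m --> \oo] --> beta g.
Hypothesis weak_null : forall g t, 0 <= t <= 1 ->
  cvg_in_prob P (fun m w => emp_null (@H m g) (fun i => p i w) t) t.
Hypothesis weak_alt : forall g t, 0 <= t <= 1 ->
  cvg_in_prob P (fun m w => emp_alt (@H m g) (fun i => p i w) t) (F g t).

Let C_gt0 : 0 < C. Proof. exact: lt_le_trans C_ge1. Qed.

Let u_lim := ustar nu beta F C alpha.
Let pow_lim := max_alt_mass nu beta F C alpha.

Definition null_frac m (w : Omega m) (t : 'I_G -> R) : R :=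
  \sum_g (num_null (@H m g))%:R / m%:R * emp_null (@H m g) (fun i => p i w) (t g).

Definition alt_frac m (w : Omega m) (t : 'I_G -> R) : R :=
  \sum_g (num_alt (@H m g))%:R / m%:R * emp_alt (@H m g) (fun i => p i w) (t g).

Let nu01 g : 0 <= nu g <= 1.
Proof.
rewrite ltW//= -mass1 (bigD1 g)//= -addrA lerDl.
by rewrite addr_ge0// sumr_ge0// => j _; exact: ltW.
Qed.

Let beta01 g : 0 <= beta g <= 1.
Proof.
rewrite ltW//= -mass1 [X in _ <= _ + X](bigD1 g)//= addrCA lerDl.
by rewrite addr_ge0// sumr_ge0// => j _; exact: ltW.
Qed.

(** The per-group error for which the total [2 * small e * G%:R] stays below [e]; [G.+1] keeps the
    denominator positive. *)
Let small (e : R) : R := e / (2 * G.+1%:R).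

Let small_gt0 e : 0 < e -> 0 < small e.
Proof. by move=> e0; rewrite divr_gt0// mulr_gt0. Qed.

Let small_le e : 0 < e -> 2 * small e * G%:R <= e.
Proof.
move=> e0; have -> : 2 * small e * G%:R = e * (2 * G%:R) / (2 * G.+1%:R).
  by rewrite /small; ring.
by rewrite ler_pdivrMr ?mulr_gt0// ler_pM2l// ler_pM2l// ler_nat.
Qed.

Lemma whp_cvg (f : nat -> R) c e : f m @[m --> \oo] --> c -> 0 < e ->
  whp P (fun m => [set w : Omega m | `|f m - c| <= e]).
Proof.
move=> /cvgrPdist_le fc e0; apply: whp_near; have := fc e e0.
by apply: filterS => m fm w; rewrite /= distrC.
Qed.

(** The bound is uniform in [t] because data-dependent thresholds are substituted later. Capping at
    1 leaves the empirical functions unchanged, since p-values are at most 1. *)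
Lemma whp_frac_ub e : 0 < e -> whp P (fun m => [set w | forall t,
  (forall g, 0 <= t g) ->
    null_frac w t <= null_mass nu (fun g => Num.min (t g) 1) + e /\
    alt_frac w t <= alt_mass beta F (fun g => Num.min (t g) 1) + e]).
Proof.
move=> e0; have d0 := small_gt0 e0.
have hA : whp P (fun m => [set w : Omega m | forall g,
    `|(num_null (@H m g))%:R / m%:R - nu g| <= small e]).
  by apply: whp_forall => g; exact: whp_cvg.
have hB : whp P (fun m => [set w : Omega m | forall g,
    `|(num_alt (@H m g))%:R / m%:R - beta g| <= small e]).
  by apply: whp_forall => g; exact: whp_cvg.
have hN : whp P (fun m => [set w | forall g, forall t, 0 <= t <= 1 ->
    emp_null (@H m g) (fun i => p i w) t <= t + small e]).
  apply: whp_forall => g.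
  apply: (@whp_uniform_ub _ _ _ P (fun m w t => emp_null _ _ t) id) => //.
  - by move=> m w s t st; rewrite !emp_nullE emp_alt_homo.
  - by move=> m t; under eq_fun do rewrite emp_nullE; exact: measurable_emp_alt.
  - by move=> t t01; exact: weak_null.
  - move=> x x0; exists (Num.min (x / 2) 1).
      by rewrite lt_min ltr01 divr_gt0//= ge_min lexx orbT.
    by rewrite /= gt_min gtr_pMr// invf_lt1// ltr1n.
have hE : whp P (fun m => [set w | forall g, forall t, 0 <= t <= 1 ->
    emp_alt (@H m g) (fun i => p i w) t <= F g t + small e]).
  apply: whp_forall => g.
  apply: (@whp_uniform_ub _ _ _ P (fun m w t => emp_alt _ _ t) (F g)) => //.
  - by move=> m w; exact: emp_alt_homo.
  - by move=> m t; exact: measurable_emp_alt.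
  - by move=> t t01; exact: weak_alt.
  - exact: concave_cdf_homo.
  - exact: concave_cdf_subadd.
  - exact: concave_cdf_right0.
apply: whp_sub (whpI (whpI hA hB) (whpI hN hE)) _ => m w [[wA wB] [wN wE]] t t0.
have T01 g : 0 <= Num.min (t g) 1 <= 1 by rewrite le_min t0 ler01 ge_min lexx orbT.
have s2 := small_le e0.
have N_le : null_frac w t <=
    null_mass nu (fun g => Num.min (t g) 1) + 2 * small e * G%:R.
  apply: weighted_sum_le => // [g||g]; [|exact: ltW|].
    by rewrite emp_nullE emp_alt_ge0 emp_alt_le1.
  by have := wN g _ (T01 g); rewrite !emp_nullE emp_alt_min1// => i; exact: p_le1.
have A_le : alt_frac w t <=
    alt_mass beta F (fun g => Num.min (t g) 1) + 2 * small e * G%:R.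
  apply: weighted_sum_le => // [g||g]; [|exact: ltW|].
    by rewrite emp_alt_ge0 emp_alt_le1.
  by have := wE g _ (T01 g); rewrite emp_alt_min1// => i; exact: p_le1.
by split; [apply: le_trans N_le _|apply: le_trans A_le _]; rewrite lerD2l.
Qed.

(** Here [T] is deterministic, so convergence in probability at the points [T g] is enough. *)
Lemma whp_frac_lb T e : in_cube T -> 0 < e ->
  whp P (fun m => [set w | mass nu beta F T - e <= null_frac w T + alt_frac w T]).
Proof.
move=> T01 e0; have e2 : 0 < e / 2 by rewrite divr_gt0.
have d0 := small_gt0 e2.
have hA : whp P (fun m => [set w : Omega m | forall g,
    `|(num_null (@H m g))%:R / m%:R - nu g| <= small (e / 2)]).
  by apply: whp_forall => g; exact: whp_cvg.
have hB : whp P (fun m => [set w : Omega m | forall g,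
    `|(num_alt (@H m g))%:R / m%:R - beta g| <= small (e / 2)]).
  by apply: whp_forall => g; exact: whp_cvg.
have hN : whp P (fun m => [set w | forall g,
    `|emp_null (@H m g) (fun i => p i w) (T g) - T g| <= small (e / 2)]).
  apply: whp_forall => g; apply: cvg_in_prob_whp d0; last exact: weak_null.
  by move=> m; under eq_fun do rewrite emp_nullE; exact: measurable_emp_alt.
have hE : whp P (fun m => [set w | forall g,
    `|emp_alt (@H m g) (fun i => p i w) (T g) - F g (T g)| <= small (e / 2)]).
  apply: whp_forall => g; apply: cvg_in_prob_whp d0; last exact: weak_alt.
  by move=> m; exact: measurable_emp_alt.
apply: whp_sub (whpI (whpI hA hB) (whpI hN hE)) _ => m w [[wA wB] [wN wE]] /=.
have s2 := small_le e2.
have N_ge : null_mass nu T - 2 * small (e / 2) * G%:R <= null_frac w T.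
  apply: weighted_sum_ge => // [g||g]; [|exact: ltW|].
    by rewrite emp_nullE emp_alt_ge0 emp_alt_le1.
  by have := wN g; rewrite ler_distl => /andP[].
have A_ge : alt_mass beta F T - 2 * small (e / 2) * G%:R <= alt_frac w T.
  apply: weighted_sum_ge => // [g||g]; [|exact: ltW|].
    by rewrite emp_alt_ge0 emp_alt_le1.
  by have := wE g; rewrite ler_distl => /andP[].
by rewrite /mass; lra.
Qed.

(** * Procedures with weights in an estimated budget set *)

Section weighted_procedure.
(** [chat] holds the coefficients of the budget: group fraction times null estimate for ADDOW, group
    fraction alone for BH and IHW. By [c_ge] the limiting budget is at least as strict as the one of
    the limit model. *)
Variables (chat : forall m, Omega m -> 'I_G -> R) (c : 'I_G -> R).
Variable W : forall m, Omega m -> R -> 'I_G -> R.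
Hypothesis chat_ge0 : forall m (w : Omega m) g, 0 <= chat w g.
Hypothesis whp_chat : forall g e, 0 < e ->
  whp P (fun m => [set w | `|chat w g - c g| <= e]).
Hypothesis c_ge : forall g, C * nu g <= c g.
Hypothesis W_weights : forall m (w : Omega m) u, 0 <= u <= 1 ->
  weights (chat w) (W w u).
Let Gh m (w : Omega m) : R -> R := Ghat m (fun g (i : 'I_(n m g)) => p i w) alpha (W w).
Let uhat m (w : Omega m) := crossing (Gh w).
Let thr m (w : Omega m) g := alpha * uhat w * W w (uhat w) g.

Hypothesis uhat_attained : forall m (w : Omega m), uhat w <= Gh w (uhat w).

Let uhat01 m (w : Omega m) : 0 <= uhat w <= 1.
Proof. by rewrite crossing_ge0 ?crossing_le1// Ghat_ge0. Qed.

Let thr_ge0 m (w : Omega m) g : 0 <= thr w g.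
Proof.
have [W0 _] := W_weights w (uhat01 w); have /andP[u0 _] := uhat01 w.
by rewrite !mulr_ge0// ltW.
Qed.

Let uhat_le m (w : Omega m) : uhat w <= null_frac w (thr w) + alt_frac w (thr w).
Proof. by rewrite -GhatE. Qed.

(** Links a realization to the limit model: the thresholds used, capped at 1, are feasible there up
    to [e]. *)
Lemma whp_capped_thresholds e : 0 < e -> whp P (fun m => [set w | exists T,
  [/\ in_cube T, C * null_mass nu T <= alpha * uhat w + e,
      uhat w <= mass nu beta F T + e,
      null_frac w (thr w) <= null_mass nu T + e &
      alt_frac w (thr w) <= alt_mass beta F T + e]]).
Proof.
move=> e0; have e2 : 0 < e / 2 by rewrite divr_gt0.
have d0 := small_gt0 e2.
have hc : whp P (fun m => [set w | forall g, `|chat w g - c g| <= small (e / 2)]).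
  by apply: whp_forall => g; exact: whp_chat.
apply: whp_sub (whpI hc (whp_frac_ub e2)) _ => m w [wc wub] /=.
exists (fun g => Num.min (thr w g) 1).
have T01 : in_cube (fun g => Num.min (thr w g) 1).
  by move=> g; rewrite le_min thr_ge0 ler01 ge_min lexx orbT.
have [N_le A_le] := wub (thr w) (thr_ge0 w).
have := uhat_le w => u_le; split=> //; rewrite ?/mass; [|lra|lra|lra].
have [W0 W1] := W_weights w (uhat01 w).
have au0 : 0 <= alpha * uhat w by rewrite mulr_ge0 ?(ltW alpha_gt0)//; have /andP[] := uhat01 w.
(* The weight budget multiplied by [alpha * uhat w]. *)
have : \sum_g chat w g * thr w g <= alpha * uhat w.
  under eq_bigr do rewrite mulrCA.
  by rewrite -mulr_sumr ler_piMr.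
have : C * null_mass nu (fun g => Num.min (thr w g) 1) <=
    \sum_g chat w g * thr w g + \sum_(g < G) small (e / 2).
  rewrite /null_mass mulr_sumr -big_split/=; apply: ler_sum => g _.
  have /andP[T0 T1] := T01 g.
  have := wc g; rewrite ler_norml => /andP[wcg _].
  have : (C * nu g) * Num.min (thr w g) 1 <= (chat w g + small (e / 2)) * Num.min (thr w g) 1.
    by rewrite ler_wpM2r//; have := c_ge g; lra.
  rewrite mulrA mulrDl => /le_trans; apply; apply: lerD.
    by rewrite ler_wpM2l// ge_min lexx.
  by rewrite ler_piMr// ltW.
rewrite sumr_const card_ord -[X in _ + X]mulr_natr.
have := small_le e2; have : 0 <= small (e / 2) * G%:R by rewrite mulr_ge0// ltW.
lra.
Qed.

Lemma whp_uhat_ub e : 0 < e -> whp P (fun m => [set w | uhat w <= u_lim + e]).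
Proof.
move=> e0.
have [del del0 delP] := level_upper C nu_gt0 beta_gt0 mass1 hF alpha_gt0 e0.
apply: whp_sub (whp_capped_thresholds del0) _ => m w [T [T01 Tu uT _ _]].
exact: delP Tu uT.
Qed.

Lemma whp_alt_ub e : 0 < e ->
  whp P (fun m => [set w | alt_frac w (thr w) <= pow_lim + e]).
Proof.
move=> e0; have ai0 : 0 < alpha^-1 by rewrite invr_gt0.
have k0 : 0 < 2 + alpha^-1 by rewrite addr_gt0.
(* Three errors add up to [e]: [x] for the level, [x / alpha] for the budget converted into a level,
   and [x] for the alternative fraction. *)
pose x := e / (2 + alpha^-1).
have x0 : 0 < x by rewrite divr_gt0.
apply: whp_sub (whpI (whp_uhat_ub x0) (whp_capped_thresholds x0)) _.
move=> m w [/= u_le [T [T01 Tu _ _ A_le]]].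
pose u := u_lim + x + x / alpha.
have xa0 : 0 < x / alpha by rewrite mulr_gt0.
have usu : u_lim <= u by rewrite /u; lra.
have Tu' : C * null_mass nu T <= alpha * u.
  apply: le_trans Tu _; rewrite /u [leRHS]mulrDr [alpha * (x / _)]mulrCA divff ?gt_eqF// mulr1.
  by rewrite lerD2r ler_pM2l.
have := alt_mass_le nu_gt0 beta_gt0 mass1 hF C_ge1 alpha_gt0 usu T01 Tu'.
have xe : x * (2 + alpha^-1) = e by rewrite divfK// gt_eqF.
rewrite -/u_lim -/pow_lim /u -xe; lra.
Qed.

Section optimal.
Hypothesis c_eq : forall g, c g = C * nu g.
Hypothesis W_opt : forall m (w : Omega m),
  optimal_weight m (fun g (i : 'I_(n m g)) => p i w) alpha (weights (chat w)) (W w).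

(** The strictly feasible pair [u], [T] of [level_lower] gives the weights [T g / (alpha * u)]. The
    budget slack absorbs the estimation error, so they are admissible; the mass slack makes their
    count at least [u]. The optimal weights do no worse, so the crossing is at least [u]. *)
Lemma whp_uhat_lb e : 0 < e -> whp P (fun m => [set w | u_lim - e <= uhat w]).
Proof.
move=> e0; have [ue|eu] := leP u_lim e.
  apply: whp_near; apply: nearW => m w /=.
  by have /andP[u0 _] := uhat01 w; rewrite (le_trans _ u0)// subr_le0.
have [u [T [u_ge /andP[u0 u1] T01 Tu uT]]] :=
  level_lower nu_gt0 beta_gt0 mass1 hF alpha_gt0 e0 eu.
have x0 : 0 < mass nu beta F T - u by rewrite subr_gt0.
have y0 : 0 < alpha * u - C * null_mass nu T by rewrite subr_gt0.
have [del del0 del_le] :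
    exists2 del, 0 < del & 2 * del * G%:R <= alpha * u - C * null_mass nu T.
  by exists (small (alpha * u - C * null_mass nu T)); [exact: small_gt0|exact: small_le].
have hc : whp P (fun m => [set w | forall g,
    `|chat w g - c g| <= del]).
  by apply: whp_forall => g; exact: whp_chat.
apply: whp_sub (whpI hc (whp_frac_lb T01 x0)) _ => m w [/= wc wm].
have u01 : 0 <= u <= 1 by rewrite ltW.
have au0 : 0 < alpha * u by rewrite mulr_gt0.
apply: le_trans u_ge _; apply: le_crossing => //.
have [_ Wu] := W_opt w u01.
have K : weights (chat w) (fun g => T g / (alpha * u)).
  split=> [g|]; first by rewrite divr_ge0 ?(ltW au0)//; have /andP[] := T01 g.
  under eq_bigr do rewrite mulrA; rewrite -mulr_suml ler_pdivrMr// mul1r.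
  apply: (@le_trans _ _ (C * null_mass nu T +
      \sum_(g < G) del)).
    rewrite /null_mass mulr_sumr -big_split/=; apply: ler_sum => g _.
    have /andP[T0 T1] := T01 g; have := wc g; rewrite ler_norml c_eq => /andP[_ wcg].
    have : chat w g * T g <= (C * nu g + del) * T g.
      by rewrite ler_wpM2r//; lra.
    rewrite mulrA mulrDl => /le_trans; apply; rewrite lerD2l ler_piMr//; exact: ltW.
  rewrite sumr_const card_ord -[X in _ + X]mulr_natr.
  have : 0 <= del * G%:R by rewrite mulr_ge0// ltW.
  lra.
apply: le_trans (Wu _ K); rewrite (GhatE _ _ (@H m)).
under eq_bigr do rewrite (mulrC _ (T _ / _)) divfK ?gt_eqF//.
under [X in _ <= _ + X]eq_bigr do rewrite (mulrC _ (T _ / _)) divfK ?gt_eqF//.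
by rewrite (le_trans _ wm)// opprB addrC subrK.
Qed.

(** Rejected alternatives are total rejections minus rejected nulls; the total is at least [uhat],
    and the nulls are limited both by the budget and by the total null mass. *)
Lemma whp_alt_lb e : 0 < e ->
  whp P (fun m => [set w | pow_lim - e <= alt_frac w (thr w)]).
Proof.
(* The losses are [x] from the level, [(alpha + 1) * x] from the null budget and [x] from the null
   fraction. *)
move=> e0; pose x := e / (alpha + 3).
have k0 : 0 < alpha + 3 by rewrite addr_gt0.
have x0 : 0 < x by rewrite divr_gt0.
apply: whp_sub (whpI (whpI (whp_uhat_ub x0) (whp_uhat_lb x0)) (whp_capped_thresholds x0)) _.
move=> m w [[/= u_le u_ge] [T [T01 Tu _ N_le _]]].
have N_min : null_mass nu T <= Num.min (alpha * u_lim / C) (\sum_g nu g) + (alpha + 1) * x.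
  have ax0 : 0 <= (alpha + 1) * x by rewrite mulr_ge0 ?addr_ge0// ltW.
  rewrite addr_minl le_min; apply/andP; split; last first.
    by rewrite (le_trans (null_mass_le nu_gt0 T01))// lerDl.
  rewrite -(@ler_pM2l _ C)// mulrDr [C * (_ / C)]mulrC divfK ?gt_eqF//.
  have : (alpha + 1) * x <= C * ((alpha + 1) * x) by rewrite ler_peMl.
  have := ler_wpM2l (ltW alpha_gt0) u_le; lra.
have := uhat_le w; have xe : x * (alpha + 3) = e by rewrite divfK// gt_eqF.
rewrite /pow_lim /max_alt_mass -/u_lim; lra.
Qed.

End optimal.

Lemma rejected_alternatives_frac m (w : Omega m) :
  #|MWBH m (fun g (i : 'I_(n m g)) => p i w) alpha (W w) :&: alternatives (@H m)|%:R =
  m%:R * alt_frac w (thr w).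
Proof.
have -> : alt_frac w (thr w) = #|MWBH m (fun g (i : 'I_(n m g)) => p i w) alpha (W w)
    :&: alternatives (@H m)|%:R / m%:R by rewrite rejected_alternativesE.
(* For [m = 0] the division carries no information, but the count is then at most 0. *)
have [m0|m0] := eqVneq (m%:R : R) 0; last by rewrite mulrC divfK.
apply/eqP; rewrite m0 mul0r eq_le ler0n andbT -m0.
exact: rejected_alternatives_le.
Qed.

Variable Rej : forall m, Omega m -> {set {g : 'I_G & 'I_(n m g)}}.
Hypothesis RejE : forall m w,
  Rej w = MWBH m (fun g (i : 'I_(n m g)) => p i w) alpha (W w).

Let rejected01 m (w : Omega m) :
  0 <= (#|Rej w :&: alternatives (@H m)|%:R : R) <= m%:R.
Proof. by rewrite ler0n/= rejected_alternatives_le. Qed.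

Let pow_lim01 : 0 <= pow_lim <= 1.
Proof. exact: max_alt_mass01. Qed.

Lemma near_Pow_le e : 0 < e ->
  \forall m \near \oo, (Pow (P m) m (@H m) (@Rej m) <= (pow_lim + e)%:E)%E.
Proof.
apply: near_expectation_le => // {}e e0.
apply: whp_sub (whp_alt_ub e0) _ => m w /= w_le.
by rewrite RejE rejected_alternatives_frac ler_wpM2l.
Qed.

Lemma near_Pow_ge e : (forall g, c g = C * nu g) ->
  (forall m (w : Omega m), optimal_weight m (fun g (i : 'I_(n m g)) => p i w)
     alpha (weights (chat w)) (W w)) -> 0 < e ->
  \forall m \near \oo, ((pow_lim - e)%:E <= Pow (P m) m (@H m) (@Rej m))%E.
Proof.
move=> c_eq W_opt; apply: near_expectation_ge => // {}e e0.
apply: whp_sub (whp_alt_lb c_eq W_opt e0) _ => m w /= w_ge.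
by rewrite RejE rejected_alternatives_frac ler_wpM2l.
Qed.

End weighted_procedure.
End asymptotics.

(** * Deriving the hypotheses of the limit model *)

Lemma optimal_uhat_attained (R : realType) (G m : nat) (n : 'I_G -> nat)
    (x : forall g, 'I_(n g) -> R) (alpha : R) (c : 'I_G -> R) (W : R -> 'I_G -> R)
    (u := crossing (Ghat m x alpha W)) :
  0 <= alpha -> optimal_weight m x alpha (weights c) W -> u <= Ghat m x alpha W u.
Proof.
move=> a0 W_opt; apply: crossing_attained; first exact: Ghat_ge0.
exact: Ghat_optimal_homo W_opt.
Qed.

(** Concavity makes the difference quotient nonincreasing, so [lim] is a genuine limit of
    nonnegative quotients. *)
Lemma slope0_ge0 (R : realType) (F : R -> R) : concave_cdf F -> (0 <= slope0 F)%E.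
Proof.
move=> hF; rewrite /slope0 (concave_cdf0 hF).
apply: lime_ge.
  apply: nonincreasing_at_right_is_cvge.
  near=> z => x y; rewrite !in_itv/= => /andP[x0 xz] /andP[y0 yz] xy.
  have z1 : z <= 1 by near: z; exact: nbhs_right_le.
  rewrite lee_fin !subr0 ler_pdivlMr// mulrAC -mulrA mulrC.
  have : x / y * F y <= F (x / y * y).
    apply: concave_cdf_scale => //; last by rewrite !ltW// (lt_le_trans yz).
    by rewrite ler_pdivrMr// mul1r xy andbT divr_ge0// ltW.
  by rewrite divfK ?gt_eqF// -mulrA (mulrC _ (F y)) (mulrC (F y / y)).
near=> x; have x0 : 0 < x by near: x; exact: nbhs_right_gt.
by rewrite lee_fin subr0 divr_ge0 ?(concave_cdf_ge0 hF)// ltW.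
Unshelve. all: by end_near. Qed.

(** Serves to deduce [0 < alpha] from the lower bound on the target level. *)
Lemma alpha_star_ge0 (R : realType) (G : nat) (pi pi0 pibar : 'I_G -> R)
    (F : 'I_G -> R -> R) :
  (forall g, 0 <= pi g) -> (forall g, 0 <= pi0 g <= 1) ->
  (forall g, concave_cdf (F g)) -> (0 <= alpha_star pi pi0 pibar F)%E.
Proof.
move=> pi_ge0 pi001 hF; apply: le_ereal_inf_tmp => _ [w [w0 _] <-].
rewrite inve_ge0; apply: sume_ge0 => g _; have /andP[q0 q1] := pi001 g.
rewrite mule_ge0 ?lee_fin ?mulr_ge0// adde_ge0 ?lee_fin// mule_ge0 ?slope0_ge0//.
by rewrite lee_fin subr_ge0.
Qed.

Lemma concave_cdf_cdf (R : realType) (d : measure_display) (T : measurableType d)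
    (P : probability T R) (X : {RV P >-> R}) (F : R -> R) :
  (forall t, cdf X t = (F t)%:E) -> strictly_concave_on01 F -> F 0 = 0 ->
  concave_cdf F.
Proof.
move=> XF F_concave F0; split=> //.
- by move=> s t st; rewrite -lee_fin -!XF cdf_nondecreasing.
- by move=> t; rewrite -lee_fin -XF cdf_le1.
move=> e e0.
have F_right : F x @[x --> 0^'+] --> F 0.
  have := cdf_right_continuous (X := X) (x := 0); rewrite (funext XF).
  by move=> /fine_cvgP[_].
have nF : \forall x \near 0^'+, F x < e.
  have /cvgrPdist_lt/(_ _ e0) := F_right.
  by apply: filterS => x; rewrite F0 sub0r normrN => /ltr_normlW.
have [x [[x0 x1] Fx]] : exists x, (0 < x /\ x <= 1) /\ F x < e.
  near ((0 : R)^'+) => x; exists x; split; last by near: x.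
  by split; near: x; [exact: nbhs_right_gt|exact: nbhs_right_le].
by exists x => //; rewrite x0.
Unshelve. all: by end_near. Qed.
Theorem corollary5p2 (R : realType) (G : nat) (hG : (2 <= G)%N)
  (d : nat -> measure_display) (Omega : forall m, measurableType (d m))
  (P : forall m, probability (Omega m) R)
  (n : nat -> 'I_G -> nat)
  (n_mono : forall g, nondecreasing_seq (fun m => n m g))
  (n_sum : forall m, (\sum_(g < G) n m g)%N = m)
  (H : forall m (g : 'I_G), 'I_(n m g) -> bool)
  (p : forall m (g : 'I_G), 'I_(n m g) -> {RV (P m) >-> R})
  (p01 : forall m g i w, 0 <= p m g i w <= 1)
  (p_null : forall m g i, H m g i = false ->
     forall A : set R, measurable A ->
       distribution (P m) (p m g i) A = uniform_prob (@ltr01 R) A)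
  (F : 'I_G -> R -> R)
  (p_alt : forall m g i, H m g i = true ->
     forall t : R, cdf (p m g i) t = (F g t)%:E)
  (F_concave : forall g, strictly_concave_on01 (F g))
  (F_0 : forall g, F g 0 = 0)
  (pi pi0 : 'I_G -> R)
  (pi_gt0 : forall g, 0 < pi g) (pi0_gt0 : forall g, 0 < pi0 g)
  (pi1_gt0 : forall g, 0 < 1 - pi0 g)
  (cvg_pi : forall g, ((n m g)%:R / m%:R : R) @[m --> \oo] --> pi g)
  (cvg_pi0 : forall g,
     ((num_null (@H m g))%:R / (n m g)%:R : R) @[m --> \oo] --> pi0 g)
  (weak_null : forall g (t : R), 0 <= t ->
     cvg_in_prob P (fun m w => emp_null (@H m g) (fun i => p m g i w) t)
       (capped t))
  (weak_alt : forall g (t : R), 0 <= t ->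
     cvg_in_prob P (fun m w => emp_alt (@H m g) (fun i => p m g i w) t)
       (F g t))
  (pihat : forall m, 'I_G -> {RV (P m) >-> R}) (pibar : 'I_G -> R)
  (pihat01 : forall m g w, 0 < pihat m g w <= 1)
  (cvg_pihat : forall g, cvg_in_prob P (fun m w => pihat m g w) (pibar g))
  (pibar_ge : forall g, pi0 g <= pibar g)
  (alpha : R)
  (alpha_gt : (alpha_star pi pi0 pibar F < alpha%:E)%E) (alpha_lt1 : alpha < 1)
  (Wstar WstarNE : forall m, Omega m -> R -> 'I_G -> R)
  (Wstar_opt : forall m w,
     optimal_weight m (fun g i => p m g i w) alpha
       (weights (fun g => (n m g)%:R / m%:R * pihat m g w)) (Wstar m w))
  (WstarNE_opt : forall m w,
     optimal_weight m (fun g i => p m g i w) alpha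
       (weights (fun g => (n m g)%:R / m%:R)) (WstarNE m w))
  (ADDOW IHW BH : forall m, Omega m -> {set {g : 'I_G & 'I_(n m g)}})
  (ADDOW_def : forall m w,
     ADDOW m w = MWBH m (fun g i => p m g i w) alpha (Wstar m w))
  (IHW_def : forall m w,
     IHW m w = MWBH m (fun g i => p m g i w) alpha (WstarNE m w))
  (BH_def : forall m w,
     BH m w = MWBH m (fun g i => p m g i w) alpha (fun _ _ => 1))
  (ADDOW_meas : forall m, measurable_rejection (ADDOW m))
  (IHW_meas : forall m, measurable_rejection (IHW m))
  (C : R) (C_ge1 : 1 <= C) (pibar_eq : forall g, pibar g = C * pi0 g) :
  exists l : R,
    Pow (P m) m (H m) (ADDOW m) @[m --> \oo] --> l%:E /\
    (limn_esup (fun m => Pow (P m) m (H m) (BH m)) <= l%:E)%E /\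
    (limn_esup (fun m => Pow (P m) m (H m) (IHW m)) <= l%:E)%E.
Proof.
pose nu g := pi g * pi0 g; pose beta g := pi g * (1 - pi0 g).
have nu_gt0 g : 0 < nu g by rewrite mulr_gt0.
have beta_gt0 g : 0 < beta g by rewrite mulr_gt0.
have cvg_nu g : ((num_null (@H m g))%:R / m%:R : R) @[m --> \oo] --> nu g.
  rewrite (_ : (fun m => _) = fun m =>
    (n m g)%:R / m%:R * ((num_null (@H m g))%:R / (n m g)%:R)); first exact: cvgM.
  apply/funext => m; have [n0|n0] := eqVneq (n m g) 0%N.
    have -> : num_null (@H m g) = 0%N.
      by apply/eqP; rewrite -leqn0 (leq_trans (leq_subr _ _))// n0.
    by rewrite !mul0r mulr0.
  by rewrite [RHS]mulrC mulrA divfK// pnatr_eq0.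
have cvg_beta g : ((num_alt (@H m g))%:R / m%:R : R) @[m --> \oo] --> beta g.
  rewrite /beta mulrBr mulr1 (_ : (fun m => _) = fun m =>
    (n m g)%:R / m%:R - (num_null (@H m g))%:R / m%:R); first exact: cvgB.
  apply/funext => m; rewrite -mulrBl -natrB ?leq_subr// subKn//.
  exact: num_alt_le.
have sum_pi : \sum_g pi g = 1.
  have cvg_sum_pi : (\sum_(g < G) (n m g)%:R / m%:R : R) @[m --> \oo] --> \sum_g pi g.
    by apply: cvg_big => [|g _]; [exact: add_continuous|exact: cvg_pi].
  rewrite -(cvg_lim _ cvg_sum_pi)//; apply: cvg_lim => //; apply: cvg_near_cst; near=> m.
  rewrite -mulr_suml -natr_sum n_sum divff// pnatr_eq0 -lt0n.
  by near: m; exact: nbhs_infty_gt.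
have mass1 : \sum_g nu g + \sum_g beta g = 1.
  rewrite -big_split/= -sum_pi; apply: eq_bigr => g _.
  by rewrite -mulrDr addrC subrK mulr1.
(* [F g] is a distribution function only through an alternative p-value; since [beta g] is positive,
   group [g] contains an alternative for some [m]. *)
have hF g : concave_cdf (F g).
  have [m [i Hi]] : exists m (i : 'I_(n m g)), H m g i.
    have /cvgr_gt/(_ _ (beta_gt0 g)) [m _ /(_ m (leqnn m))/=] := cvg_beta g.
    have [/existsP[i Hi] _|/existsPn noH] := boolP [exists i, @H m g i].
      by exists m, i.
    rewrite /num_alt big1 ?mul0r ?ltxx// => i _.
    by rewrite (negbTE (noH i)).
  by apply: (@concave_cdf_cdf _ _ _ _ (p m g i)) => //; exact: p_alt.
have alpha_gt0 : 0 < alpha.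
  rewrite -lte_fin; apply: le_lt_trans alpha_gt; apply: alpha_star_ge0 => // g.
    exact: ltW.
  by rewrite ltW//= -subr_ge0 ltW.
have alpha_ge0 := ltW alpha_gt0.
have weak_null01 g t : 0 <= t <= 1 ->
    cvg_in_prob P (fun m w => emp_null (@H m g) (fun i => p m g i w) t) t.
  move=> /andP[t0 t1]; have := weak_null g t t0; rewrite /capped (min_idPl t1).
  by have [//|t0'] := ltP 0 t; rewrite (le_anti (introT andP (conj t0 t0'))).
have weak_alt01 g t : 0 <= t <= 1 ->
    cvg_in_prob P (fun m w => emp_alt (@H m g) (fun i => p m g i w) t) (F g t).
  by move=> /andP[t0 _]; exact: weak_alt.
have p_le1 m g (i : 'I_(n m g)) w : p m g i w <= 1 by have /andP[] := p01 m g i w.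
(* Otherwise some estimator value would come within half the excess of [pibar g], hence above 1. *)
have pibar_le1 g : pibar g <= 1.
  rewrite leNgt; apply/negP => pibar_gt1.
  have e0 : 0 < (pibar g - 1) / 2 by rewrite divr_gt0// subr_gt0.
  have := cvg_in_prob_whp (fun m => measurable_funPT (pihat m g)) (cvg_pihat g) e0.
  move=> /whp_nonempty[m [w /=]]; rewrite ler_distl => /andP[+ _].
  by have /andP[_] := pihat01 m g w; lra.
have pi_le1 g : pi g <= 1.
  by rewrite -sum_pi (bigD1 g)//= lerDl sumr_ge0// => j _; exact: ltW.
(* Proportionality enters here: the limiting ADDOW budget becomes [C] times the null mass. *)
have cE g : pi g * pibar g = C * nu g by rewrite pibar_eq mulrCA.
have whp_pi g e : 0 < e -> whp P (fun m => [set w : Omega m | `|(n m g)%:R / m%:R - pi g| <= e]).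
  exact: whp_cvg.
have whp_pipihat g e : 0 < e -> whp P (fun m => [set w : Omega m |
    `|(n m g)%:R / m%:R * pihat m g w - pi g * pibar g| <= e]).
  move=> e0; have e2 : 0 < e / 2 by rewrite divr_gt0.
  have := cvg_in_prob_whp (fun m => measurable_funPT (pihat m g)) (cvg_pihat g) e2.
  move=> /(whpI (whp_pi g _ e2)) /whp_sub; apply => m w [/= wpi wq].
  have /andP[q0 q1] := pihat01 m g w.
  rewrite (_ : _ - _ = ((n m g)%:R / m%:R - pi g) * pihat m g w +
    pi g * (pihat m g w - pibar g)); last by ring.
  rewrite (le_trans (ler_normD _ _))// [leRHS]splitr !normrM.
  apply: lerD; apply: le_trans (_ : _ <= e / 2) => //.
    by apply: le_trans wpi; rewrite ler_piMr// gtr0_norm.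
  by apply: le_trans wq; rewrite ler_piMl// gtr0_norm.
have ADDOW_att m (w : Omega m) := optimal_uhat_attained alpha_ge0 (Wstar_opt m w).
have IHW_att m (w : Omega m) := optimal_uhat_attained alpha_ge0 (WstarNE_opt m w).
have BH_att m (w : Omega m) :
    crossing (Ghat m (fun g i => p m g i w) alpha (fun _ _ => 1)) <=
    Ghat m (fun g i => p m g i w) alpha (fun _ _ => 1)
      (crossing (Ghat m (fun g i => p m g i w) alpha (fun _ _ => 1))).
  apply: crossing_attained; first exact: Ghat_ge0.
  move=> u v _ _; exact: (@Ghat_cst_homo R G m (n m) _ alpha (fun=> 1) u v alpha_ge0 (fun=> ler01)).
have n_ge0 m g : 0 <= (n m g)%:R / m%:R :> R by rewrite divr_ge0.
(* This is [c_ge] for BH and IHW, whose limiting budget coefficients are [pi g]. *)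
have nu_le g : C * nu g <= pi g by rewrite -cE ler_piMr// ltW.
have BH_weights m (w : Omega m) (u : R) : 0 <= u <= 1 ->
    weights (fun g => (n m g)%:R / m%:R : R) (fun=> 1).
  move=> _; split=> // ; under eq_bigr do rewrite mulr1.
  rewrite -mulr_suml -natr_sum n_sum; have [->|m0] := eqVneq m 0%N.
    by rewrite mul0r.
  by rewrite divff// pnatr_eq0.
have Pow_le := near_Pow_le n_sum p_le1 nu_gt0 beta_gt0 mass1 hF C_ge1 alpha_gt0
  cvg_nu cvg_beta weak_null01 weak_alt01.
have Pow_ge := near_Pow_ge n_sum p_le1 nu_gt0 beta_gt0 mass1 hF C_ge1 alpha_gt0
  cvg_nu cvg_beta weak_null01 weak_alt01.
have npihat_ge0 m (w : Omega m) g : 0 <= (n m g)%:R / m%:R * pihat m g w.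
  by rewrite mulr_ge0//; have /andP[/ltW] := pihat01 m g w.
have c_ge g : C * nu g <= pi g * pibar g by rewrite cE.
have Wstar_weights m (w : Omega m) u (u01 : 0 <= u <= 1) := proj1 (Wstar_opt m w u u01).
have WstarNE_weights m (w : Omega m) u (u01 : 0 <= u <= 1) := proj1 (WstarNE_opt m w u u01).
exists (max_alt_mass nu beta F C alpha); split; [|split].
- apply: cvge_near_bounds => e e0.
  + exact: (Pow_le _ _ _ npihat_ge0 whp_pipihat c_ge Wstar_weights ADDOW_att _ ADDOW_def _ e0).
  + exact: (Pow_ge _ _ _ npihat_ge0 whp_pipihat c_ge Wstar_weights ADDOW_att _ ADDOW_def
      _ cE Wstar_opt e0).
- apply: limn_esup_le_near => e e0.
  exact: (Pow_le _ _ (fun m w _ _ => 1) (fun m w => n_ge0 m) whp_pi nu_le BH_weights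
    BH_att _ BH_def _ e0).
- apply: limn_esup_le_near => e e0.
  exact: (Pow_le _ _ _ (fun m w => n_ge0 m) whp_pi nu_le WstarNE_weights IHW_att
    _ IHW_def _ e0).
Unshelve. all: by end_near. Qed.
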